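(* Let $N\geq 5$ be an integer and let $\alpha,\beta\in\mathbb{R}$ satisfy $\alpha>2-N$ and $\alpha-2<\beta\leq \frac{N}{N-2}\alpha$. Put $p^*_{\alpha,\beta}=\frac{2(N+\beta)}{N-4+2\alpha-\beta}$. Then there is a constant $\mathcal{S}>0$ (depending only on $N,\alpha,\beta$) such that $$\int_{\mathbb{R}^N}|x|^{-\beta}\left|\mathrm{div}(|x|^{\alpha}\nabla u)\right|^2\,\mathrm{d}x\;\geq\;\mathcal{S}\left(\int_{\mathbb{R}^N}|x|^{\beta}|u|^{p^*_{\alpha,\beta}}\,\mathrm{d}x\right)^{\frac{2}{p^*_{\alpha,\beta}}}\quad\text{for all } u\in C^\infty_0(\mathbb{R}^N).$$
   Context: $C_0^\infty(\mathbb{R}^N)$ denotes the smooth compactly supported functions on $\mathbb{R}^N$. *)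

(* Defs.v *)
From HB Require Import structures.
From mathcomp Require Import all_boot all_order all_algebra.
From mathcomp Require Import all_classical all_reals all_analysis.
Import Order.TTheory GRing.Theory Num.Theory.
Import numFieldNormedType.Exports.

Set Implicit Arguments.
Unset Strict Implicit.
Unset Printing Implicit Defensive.

Local Open Scope classical_set_scope.
Local Open Scope ring_scope.

Definition measure_rV_display : measure_display -> measure_display.
Proof. exact. Qed.

(* 'rV[T]_n carries the product sigma-algebra, as n.-tuple T does in the
   library; for T = R this is the Borel sigma-algebra of R^n. *)
Section measurable_rV.
Context {d} {T : measurableType d}.
Context (n : nat).

Let coors : 'I_n -> 'rV[T]_n -> T := fun i x => x ord0 i.

Let rV_set0 : g_sigma_preimage coors set0.
Proof. exact: sigma_algebra0. Qed.

Let rV_setC A : g_sigma_preimage coors A -> g_sigma_preimage coors (~` A).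
Proof. exact: sigma_algebraC. Qed.

Let rV_bigcup (F : _^nat) : (forall i, g_sigma_preimage coors (F i)) ->
  g_sigma_preimage coors (\bigcup_i (F i)).
Proof. exact: sigma_algebra_bigcup. Qed.

HB.instance Definition _ := @isMeasurable.Build (measure_rV_display d)
  'rV[T]_n (g_sigma_preimage coors) rV_set0 rV_setC rV_bigcup.

Lemma measurable_coord_rV (i : 'I_n) :
  measurable_fun [set: 'rV[T]_n] (fun x : 'rV[T]_n => x ord0 i).
Proof.
move=> _ Y mY; rewrite setTI; apply: sub_sigma_algebra => /=.
rewrite -bigcup_seq/=; exists i => /=; first by rewrite mem_index_enum.
by exists Y => //; rewrite setTI.
Qed.

Lemma measurable_fun_rVP d' (U : measurableType d') (f : U -> 'rV[T]_n) :
  (forall i, measurable_fun [set: U] (fun x => f x ord0 i)) ->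
  measurable_fun [set: U] f.
Proof.
move=> mf _ Y mY; rewrite setTI.
pose G : set (set 'rV[T]_n) := [set A | measurable (f @^-1` A)].
suff : G Y by [].
move: Y mY; apply: smallest_sub.
  split => [|A GA|F GF]; rewrite /G/=.
  - by rewrite preimage_set0.
  - by rewrite setTD -preimage_setC; exact: measurableC.
  - by rewrite preimage_bigcup; apply: bigcup_measurable => k _; exact: GF.
move=> A; rewrite -bigcup_seq/= => -[i _ [B mB <-]].
by rewrite /G/= setTI -comp_preimage -[X in measurable X]setTI; exact: mf.
Qed.

End measurable_rV.

Section cons_rV.
Context {R : realType}.

Definition cons_rV n (p : R * 'rV[R]_n) : 'rV[R]_n.+1 :=
  row_mx (p.1)%:M p.2 : 'rV[R]_(1 + n).

Lemma cons_rV0 n (p : R * 'rV[R]_n) : cons_rV p ord0 ord0 = p.1.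
Proof.
have -> : @ord0 n = lshift n (@ord0 0) by exact: val_inj.
by apply: etrans (row_mxEl _ _ _ _) _; rewrite mxE eqxx.
Qed.

Lemma cons_rVS n (p : R * 'rV[R]_n) (i : 'I_n) :
  cons_rV p ord0 (lift ord0 i) = p.2 ord0 i.
Proof.
have -> : lift ord0 i = rshift 1 i by exact: val_inj.
exact: row_mxEr.
Qed.

Lemma measurable_cons_rV n : measurable_fun [set: R * 'rV[R]_n] (@cons_rV n).
Proof.
apply: measurable_fun_rVP => i; case: (unliftP ord0 i) => [j ->|->].
  under eq_fun do rewrite cons_rVS.
  by apply: (measurableT_comp (measurable_coord_rV j)); exact: measurable_snd.
by under eq_fun do rewrite cons_rV0; exact: measurable_fst.
Qed.

Definition uncons_rV n (x : 'rV[R]_n.+1) : R * 'rV[R]_n :=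
  (x ord0 ord0, \row_i x ord0 (lift ord0 i)).

Lemma cons_rVK n : cancel (@cons_rV n) (@uncons_rV n).
Proof.
move=> [a y]; rewrite /uncons_rV cons_rV0; congr pair.
by apply/rowP => i; rewrite mxE cons_rVS.
Qed.

Lemma measurable_uncons_rV n :
  measurable_fun [set: 'rV[R]_n.+1] (@uncons_rV n).
Proof.
apply: measurable_fun_pair; first exact: measurable_coord_rV.
apply: measurable_fun_rVP => i.
by under eq_fun do rewrite mxE; exact: measurable_coord_rV.
Qed.

End cons_rV.

(* n-dimensional Lebesgue measure: the n-fold product of the Lebesgue measure
   of R, transported along the identification of R * R^n with R^n.+1. *)
Fixpoint lebesgue_rV {R : realType} (n : nat) : set 'rV[R]_n -> \bar R :=
  match n with
  | 0 => \d_(0 : 'rV[R]_0)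
  | n'.+1 => pushforward (@lebesgue_measure R \x @lebesgue_rV R n')%E
               (@cons_rV R n')
  end.

Arguments lebesgue_rV {R} n _.

Section lebesgue_rV_measure.
Context {R : realType}.
Local Open Scope ereal_scope.

Let is_sfm n (mu : set 'rV[R]_n -> \bar R) :=
  [/\ mu set0 = 0, forall A, 0 <= mu A, semi_sigma_additive mu
    & sigma_finite [set: 'rV[R]_n] mu].

Let pushforward_cons_rV_sfm n
    (m : {sigma_finite_measure set 'rV[R]_n -> \bar R}) :
  is_sfm (pushforward (@lebesgue_measure R \x m) (@cons_rV R n)).
Proof.
pose M : {measure set (measurableTypeR R * 'rV[R]_n)%type -> \bar R} :=
  (@lebesgue_measure R \x m)%E.
have mcons := @measurable_cons_rV R n.
have mpre (A : set 'rV[R]_n.+1) :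
    measurable A -> measurable (@cons_rV R n @^-1` A).
  by move=> mA; rewrite -[X in measurable X]setTI; exact: mcons.
rewrite -[_ \x _]/(M : set _ -> \bar R) /pushforward; split.
- by rewrite preimage_set0 measure0.
- by move=> A; exact: measure_ge0.
- move=> F mF tF mUF; rewrite preimage_bigcup.
  apply: (@measure_semi_sigma_additive _ _ _ M) => [k||].
  + exact: mpre.
  + apply/trivIsetP => /= i j _ _ ij; rewrite -preimage_setI.
    by move/trivIsetP : tF => /(_ _ _ _ _ ij) ->//; rewrite preimage_set0.
  + by rewrite -preimage_bigcup; exact: mpre.
- have /sigma_finiteP[F [FT ndF Foo]] := sigma_finiteT (@lebesgue_measure R).
  have /sigma_finiteP[G [GT ndG Goo]] := sigma_finiteT m.
  exists (fun k => @uncons_rV R n @^-1` (F k `*` G k)).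
    apply/seteqP; split => // x _.
    have [k1 _ Fk1] : (\bigcup_i F i) (uncons_rV x).1 by rewrite -FT.
    have [k2 _ Gk2] : (\bigcup_i G i) (uncons_rV x).2 by rewrite -GT.
    exists (maxn k1 k2) => //; split.
      by move: Fk1; apply/subsetPset/ndF/leq_maxl.
    by move: Gk2; apply/subsetPset/ndG/leq_maxr.
  move=> k; have [mF Fk] := Foo k; have [mG Gk] := Goo k; split.
    rewrite -[X in measurable X]setTI.
    by apply: (@measurable_uncons_rV R n) => //; exact: measurableX.
  rewrite -comp_preimage (_ : _ \o _ = id); last first.
    by apply/funext => p /=; rewrite cons_rVK.
  by rewrite preimage_id /M/= product_measure1E// lte_mul_pinfty// ge0_fin_numE.
Qed.

Section step.
Context (n : nat) (mu : set 'rV[R]_n -> \bar R).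

Definition sfm_of of is_sfm mu : set 'rV[R]_n -> \bar R := mu.

Context (mu_sfm : is_sfm mu).

Let m0 : sfm_of mu_sfm set0 = 0. Proof. by case: mu_sfm. Qed.
Let m_ge0 A : 0 <= sfm_of mu_sfm A. Proof. by case: mu_sfm. Qed.
Let m_sa : semi_sigma_additive (sfm_of mu_sfm).
Proof. by case: mu_sfm. Qed.
Let m_sf : sigma_finite [set: 'rV[R]_n] (sfm_of mu_sfm).
Proof. by case: mu_sfm. Qed.

HB.instance Definition _ :=
  isMeasure.Build _ _ _ (sfm_of mu_sfm) m0 m_ge0 m_sa.
HB.instance Definition _ :=
  Measure_isSigmaFinite.Build _ _ _ (sfm_of mu_sfm) m_sf.

Lemma is_sfm_step :
  is_sfm (pushforward (@lebesgue_measure R \x mu) (@cons_rV R n)).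
Proof. exact: (pushforward_cons_rV_sfm (sfm_of mu_sfm)). Qed.

End step.

Lemma lebesgue_rV_sfm n : is_sfm (@lebesgue_rV R n).
Proof.
elim: n => [|n ih] /=; last exact: is_sfm_step.
split; [exact: measure0|exact: measure_ge0|
        exact: measure_semi_sigma_additive|exact: sigma_finiteT].
Qed.

Context (n : nat).

Let lebesgue_rV0 : @lebesgue_rV R n set0 = 0.
Proof. by case: (lebesgue_rV_sfm n). Qed.

Let lebesgue_rV_ge0 A : 0 <= @lebesgue_rV R n A.
Proof. by case: (lebesgue_rV_sfm n). Qed.

Let lebesgue_rV_semi_sigma_additive : semi_sigma_additive (@lebesgue_rV R n).
Proof. by case: (lebesgue_rV_sfm n). Qed.

HB.instance Definition _ := isMeasure.Build _ _ _ (@lebesgue_rV R n)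
  lebesgue_rV0 lebesgue_rV_ge0 lebesgue_rV_semi_sigma_additive.

Let lebesgue_rV_sigma_finite : sigma_finite setT (@lebesgue_rV R n).
Proof. by case: (lebesgue_rV_sfm n). Qed.

HB.instance Definition _ := Measure_isSigmaFinite.Build _ _ _
  (@lebesgue_rV R n) lebesgue_rV_sigma_finite.

End lebesgue_rV_measure.

Section lebesgue_rV_box.
Context {R : realType}.

Lemma lebesgue_rV_box n (a b : 'rV[R]_n) :
  (forall i, a ord0 i <= b ord0 i) ->
  lebesgue_rV n [set x : 'rV[R]_n | forall i, x ord0 i \in `[a ord0 i, b ord0 i]]
  = (\prod_(i < n) (b ord0 i - a ord0 i))%:E.
Proof.
elim: n a b => [|n ih] a b ab.
  by rewrite big_ord0 /= diracE mem_set// => -[].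
rewrite /= /pushforward.
set B := [set y : 'rV[R]_n | forall i,
  y ord0 i \in `[a ord0 (lift ord0 i), b ord0 (lift ord0 i)]].
have -> : @cons_rV R n @^-1`
    [set x | forall i, x ord0 i \in `[a ord0 i, b ord0 i]] =
    [set` `[a ord0 ord0, b ord0 ord0]] `*` B.
  apply/seteqP; split => [p /= h|p /= [h1 h2] i].
    split; first by have := h ord0; rewrite cons_rV0.
    by move=> i; have := h (lift ord0 i); rewrite cons_rVS.
  by case: (unliftP ord0 i) => [j ->|->]; rewrite ?cons_rVS ?cons_rV0.
have mB : measurable B.
  rewrite (_ : B = \bigcap_(i in [set: 'I_n]) ((fun y : 'rV[R]_n => y ord0 i)
      @^-1` [set` `[a ord0 (lift ord0 i), b ord0 (lift ord0 i)]])); last first.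
    by apply/seteqP; split => [y yB i _|y yB i]; [exact: yB|exact: (yB i)].
  apply: fin_bigcap_measurable => // i _; rewrite -[X in measurable X]setTI.
  by apply: measurable_coord_rV => //; exact: measurable_itv.
rewrite (@product_measure1E _ _ _ _ _ lebesgue_measure (@lebesgue_rV R n))//.
have hB : lebesgue_rV n B =
    (\prod_(i < n) (b ord0 (lift ord0 i) - a ord0 (lift ord0 i)))%:E.
  have := ih (\row_i a ord0 (lift ord0 i)) (\row_i b ord0 (lift ord0 i)).
  rewrite (_ : [set x | _] = B); last first.
    by apply/seteqP; split => y yB i; have := yB i; rewrite !mxE.
  move=> ->; last by move=> i; rewrite !mxE.
  by congr EFin; apply: eq_bigr => i _; rewrite !mxE.
rewrite big_ord_recl EFinM; congr (_ * _)%E; last exact: hB.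
apply: etrans (lebesgue_measure_itv _) _; rewrite /= lte_fin.
have := ab ord0; rewrite le_eqVlt => /orP[/eqP->|->//].
by rewrite ltxx subrr.
Qed.

End lebesgue_rV_box.

Section differential_operators.
Context {R : realType} {n : nat}.
Implicit Types (u : 'rV[R]_n -> R) (V : 'rV[R]_n -> 'rV[R]_n) (x : 'rV[R]_n).

(* The library's norm on 'rV[R]_n is the sup norm. *)
Definition eucl_norm x : R := Num.sqrt (\sum_(i < n) x ord0 i ^+ 2).

Definition partial (i : 'I_n) u : 'rV[R]_n -> R :=
  fun x => 'D_(delta_mx ord0 i) u x.

Definition gradient u : 'rV[R]_n -> 'rV[R]_n := fun x => \row_i partial i u x.

Definition divergence V : 'rV[R]_n -> R :=
  fun x => \sum_(i < n) partial i (fun y => V y ord0 i) x.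

(* All partial derivatives of all orders exist everywhere and are continuous;
   s lists the directions of differentiation. *)
Definition smooth u : Prop := forall s : seq 'I_n,
  continuous (foldr partial u s) /\
  (forall (i : 'I_n) x, derivable (foldr partial u s) x (delta_mx ord0 i)).

Definition compactly_supported u : Prop :=
  compact (closure [set x | u x != 0]).

End differential_operators.

(* Main.v *)
(* Write I(f) for the integral of f over R^N and test div(|x|^alpha grad u)
   against |u|^(q-2) u, where q = p/2 + 1 and p is the critical exponent. With
   w = |u|^(q/2), integration by parts gives
     (4(q-1)/q^2) I(|x|^alpha |grad w|^2)
       = - I(div(|x|^alpha grad u) |u|^(q-2) u)
       <= I(|x|^-beta |div(|x|^alpha grad u)|^2)^(1/2) I(|x|^beta |u|^p)^(1/2),
   as 2(q-1) = p. The first-order Caffarelli-Kohn-Nirenberg inequality bounds the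
   left-hand side from below by a multiple of I(|x|^beta |w|^s)^(2/s), where
   s = 4p/(p+2), and |w|^s = |u|^p; the theorem follows as 2/s - 1/2 = 1/p.
   The first-order inequality interpolates between Hardy's inequality and the
   case s = 2N/(N-2), which is Sobolev's inequality for |x|^(alpha/2) w.
   The singular weights are avoided by multiplying w with a cutoff vanishing on a
   ball of radius e^(1/2) around the origin; as alpha > 2 - N the error made is
   O(e^((N-2+alpha)/2)). *)

Require Import Defs.
From mathcomp Require Import all_boot all_order all_algebra.
From mathcomp Require Import all_classical all_reals all_analysis.
From mathcomp Require Import measurable_realfun ring lra.
Import Order.TTheory GRing.Theory Num.Theory.
Import numFieldNormedType.Exports.

Local Open Scope classical_set_scope.
Local Open Scope ring_scope.

(** In the code [k] is q - 1 = p/2. Powers of |x| are replaced by powers of a positive C^1 function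
    of |x|^2 that agrees with |x|^2 outside the removed ball. Every integrand is then continuous
    with compact support, its integral is a real number, and terms can be moved across inequalities.
    The price of the cutoff is that the truncated integral X only satisfies X^(1/2 + 1/p) <= P
    X^(1/2) + error, where the error involves sup |u|, and dividing by X^(1/2) is not uniform in u.
    As X grows when e decreases, a nonzero X stays bounded below while the error tends to 0; hence
    the final constant keeps no trace of u. Sobolev's inequality is proved from scratch: an L^1
    gradient bound, by induction on the dimension, is applied to a power of the function. The
    condition N >= 5 enters through the positivity of the denominator of p and through s <= 2N/(N-2)
    <= 10/3, which fixes the power of the cutoff. The two bounds on beta put the interpolation
    parameter between Hardy and Sobolev in (0, 1]; the lower one also gives k > 1, which makes the
    test function C^1. *)

(** * Fubini and Tonelli with the first coordinate split off *)

Section integral_slices.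
Context {R : realType} (n : nat).
Local Open Scope ereal_scope.
Implicit Types f : 'rV[R]_n.+1 -> \bar R.

Let M : {sigma_finite_measure set 'rV[R]_n -> \bar R} := lebesgue_rV n.

Let P : {measure set (measurableTypeR R * 'rV[R]_n)%type -> \bar R} :=
  (@lebesgue_measure R \x M).

Let mcons : @measurable_fun _ _ (measurableTypeR R * 'rV[R]_n)%type
  'rV[R]_n.+1 setT (@cons_rV R n).
Proof. by move=> _ Y mY; exact: (@measurable_cons_rV R n measurableT Y mY). Qed.

Lemma ge0_integral_rVS f : measurable_fun [set: 'rV[R]_n.+1] f ->
  (forall x, 0 <= f x) ->
  \int[lebesgue_rV n.+1]_x f x =
  \int[@lebesgue_measure R \x M]_p f (cons_rV p).
Proof.
move=> mf f0.
rewrite -[RHS](@ge0_integral_pushforward _ _ _ _ _ _ mcons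
  P setT f)//.
Qed.

(** Here the first axis is integrated innermost, which suits one-dimensional estimates along that
    axis; the variant ending in [12] has it outermost, which suits induction over slices. *)
Lemma ge0_integral_rVS21 f : measurable_fun [set: 'rV[R]_n.+1] f ->
  (forall x, 0 <= f x) ->
  \int[lebesgue_rV n.+1]_x f x =
  \int[lebesgue_rV n]_y \int[@lebesgue_measure R]_t f (cons_rV (t, y)).
Proof.
move=> mf f0; rewrite ge0_integral_rVS// fubini_tonelli2//.
by exact: measurableT_comp mf mcons.
Qed.

Lemma ge0_integral_rVS12 f : measurable_fun [set: 'rV[R]_n.+1] f ->
  (forall x, 0 <= f x) ->
  \int[lebesgue_rV n.+1]_x f x =
  \int[@lebesgue_measure R]_t \int[lebesgue_rV n]_y f (cons_rV (t, y)).
Proof.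
move=> mf f0; rewrite ge0_integral_rVS// fubini_tonelli1//.
by exact: measurableT_comp mf mcons.
Qed.

Lemma integrable_rVS f : (lebesgue_rV n.+1).-integrable setT f ->
  (@lebesgue_measure R \x M).-integrable setT (fun p => f (cons_rV p)).
Proof.
move=> /integrableP[mf foo]; apply/integrableP; split.
  by exact: measurableT_comp mf mcons.
rewrite -(@ge0_integral_rVS (fun x => `|f x|))//.
exact: measurableT_comp.
Qed.

Lemma integral_rVS f : (lebesgue_rV n.+1).-integrable setT f ->
  \int[lebesgue_rV n.+1]_x f x =
  \int[@lebesgue_measure R \x M]_p f (cons_rV p).
Proof.
move=> fi; apply/esym.
rewrite -[LHS](@integral_pushforward _ _ _ _ _ _ mcons
  P setT f)//.
- by case/integrableP : fi.
- exact: integrable_rVS.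
Qed.

Lemma integral_rVS21 f : (lebesgue_rV n.+1).-integrable setT f ->
  \int[lebesgue_rV n.+1]_x f x =
  \int[lebesgue_rV n]_y \int[@lebesgue_measure R]_t f (cons_rV (t, y)).
Proof.
move=> fi; rewrite integral_rVS//.
by rewrite -(integral21_prod_meas1 (integrable_rVS _ fi)).
Qed.

Lemma integral_rVS12 f : (lebesgue_rV n.+1).-integrable setT f ->
  \int[lebesgue_rV n.+1]_x f x =
  \int[@lebesgue_measure R]_t \int[lebesgue_rV n]_y f (cons_rV (t, y)).
Proof.
move=> fi; rewrite integral_rVS//.
by rewrite -(integral12_prod_meas1 (integrable_rVS _ fi)).
Qed.

End integral_slices.

(** * Hölder's inequality with values in [0, +oo] *)

Section hoelder_ereal.
Context d (T : measurableType d) (R : realType).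
Variable mu : {measure set T -> \bar R}.
Local Open Scope ereal_scope.

(** Extended values occur because slice integrals of a measurable function may be infinite. An
    infinite or zero integral is settled by hand, with 0 times +oo equal to 0; otherwise both
    functions are finite almost everywhere and the real inequality applies with exponents 1/a and
    1/b. *)
Lemma hoelder_weighted (f g : T -> \bar R) (a b : R) :
  measurable_fun setT f -> measurable_fun setT g ->
  (forall x, 0 <= f x) -> (forall x, 0 <= g x) ->
  (0 < a)%R -> (0 < b)%R -> (a + b = 1)%R ->
  \int[mu]_x (f x `^ a * g x `^ b) <=
  (\int[mu]_x f x) `^ a * (\int[mu]_x g x) `^ b.
Proof.
wlog : f g a b / \int[mu]_x f x != +oo \/ \int[mu]_x g x = 0 => [WL|].
  move=> mf mg f0 g0 a0 b0 ab.
  have [foo|foo] := eqVneq (\int[mu]_x f x) +oo; last by apply: WL => //; left.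
  have [goo|goo] := eqVneq (\int[mu]_x g x) 0; first by apply: WL => //; right.
  have -> : (\int[mu]_x f x) `^ a = +oo by rewrite foo poweRyr// gt_eqF.
  rewrite gt0_mulye ?leey// poweR_gt0// lt0e goo/=.
  by apply: integral_ge0 => x _; exact: g0.
move=> fg mf mg f0 g0 a0 b0 ab.
have mpow (h : T -> \bar R) c : measurable_fun setT h ->
    measurable_fun setT (fun x => h x `^ c).
  by move=> mh; exact: (measurableT_comp (measurable_poweR c) mh).
have mfg : measurable_fun setT (fun x => f x `^ a * g x `^ b).
  by apply: emeasurable_funM; exact: mpow.
have zero (h : T -> \bar R) : measurable_fun setT h -> (forall x, 0 <= h x) ->
    \int[mu]_x h x = 0 -> ae_eq mu setT h (cst 0).
  move=> mh h0 ih; apply/ae_eq_integral_abs => //.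
  by rewrite -ih; apply: eq_integral => x _; rewrite gee0_abs.
have fin (h : T -> \bar R) : measurable_fun setT h -> (forall x, 0 <= h x) ->
    \int[mu]_x h x != +oo -> ae_eq mu setT h (fun x => (fine (h x))%:E).
  move=> mh h0 ih.
  have : mu.-integrable setT h.
    apply/integrableP; split => //.
    under eq_integral do rewrite gee0_abs//.
    by rewrite ltey.
  move/integrable_ae => /(_ measurableT).
  by apply: filterS => x /= hx _; rewrite fineK// hx.
have lhs0 : ae_eq mu setT f (cst 0) \/ ae_eq mu setT g (cst 0) ->
    \int[mu]_x (f x `^ a * g x `^ b) <=
      (\int[mu]_x f x) `^ a * (\int[mu]_x g x) `^ b.
  move=> h0; rewrite (_ : \int[mu]_x _ = 0) ?mule_ge0 ?poweR_ge0//.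
  rewrite (@ge0_ae_eq_integral _ _ _ mu setT _ (cst 0))//; first by rewrite integral0.
    by move=> x _; rewrite mule_ge0// poweR_ge0.
  case: h0; apply: filterS => x /= h _; rewrite h// poweR0r ?gt_eqF//.
    by rewrite mul0e.
  by rewrite mule0.
have [goo|goo] := eqVneq (\int[mu]_x g x) +oo.
  have [f00|f00] := eqVneq (\int[mu]_x f x) 0.
    by apply: lhs0; left; exact: zero.
  have -> : (\int[mu]_x g x) `^ b = +oo by rewrite goo poweRyr// gt_eqF.
  rewrite gt0_muley ?leey// poweR_gt0// lt0e f00/=.
  by apply: integral_ge0 => x _; exact: f0.
case: fg => [foo|g00]; last by apply: lhs0; right; exact: zero.
have fE := fin f mf f0 foo; have gE := fin g mg g0 goo.
pose F x := (fine (f x) `^ a)%R; pose G x := (fine (g x) `^ b)%R.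
have mfine (h : T -> \bar R) : measurable_fun setT h ->
    measurable_fun setT (fun x => fine (h x)).
  by move=> mh; exact: measurableT_comp mh.
have mF : measurable_fun setT F.
  by apply: (measurableT_comp (measurable_powR _)); exact: mfine.
have mG : measurable_fun setT G.
  by apply: (measurableT_comp (measurable_powR _)); exact: mfine.
have := @hoelder _ _ _ mu F G a^-1 b^-1 mF mG.
rewrite !invr_gt0 !invrK => /(_ a0 b0 ab).
have norm (h : T -> \bar R) c : measurable_fun setT h -> (0 < c)%R ->
    (forall x, 0 <= h x) ->
    ae_eq mu setT h (fun x => (fine (h x))%:E) ->
    Lnorm mu (c^-1)%:E (EFin \o (fun x => (fine (h x) `^ c)%R)) =
    (\int[mu]_x h x) `^ c.
  move=> mh c0 h0 hE; rewrite unlock invrK; congr (_ `^ _).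
  rewrite [RHS](@ge0_ae_eq_integral _ _ _ mu setT _ (fun x => (fine (h x))%:E))//.
  - apply: eq_integral => x _ /=.
    rewrite ger0_norm ?powR_ge0// -powRrM mulfV ?gt_eqF//.
    by rewrite powRr1// fine_ge0.
  - by apply/measurable_EFinP; exact: mfine.
  - by move=> x _; rewrite lee_fin fine_ge0.
rewrite (norm f)// (norm g)// Lnorm1; apply: le_trans.
rewrite (@ge0_ae_eq_integral _ _ _ mu setT _ (fun x => `|(EFin \o (F \* G)%R) x|))//.
- apply: measurableT_comp => //; apply/measurable_EFinP.
  exact: measurable_funM.
- by move=> x _; rewrite mule_ge0// poweR_ge0.
apply: filterS2 fE gE => x /= fE gE _; rewrite fE// gE// !poweR_EFin.
by rewrite /F /G/= ger0_norm// mulr_ge0// powR_ge0.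
Qed.

End hoelder_ereal.

(** * The Gagliardo-Nirenberg inequality, by induction on the dimension *)

Section sobolev_slices.
Context {R : realType}.
Local Open Scope ereal_scope.

Lemma measurable_cons_rVr n (t : R) :
  measurable_fun [set: 'rV[R]_n] (fun y => cons_rV (t, y)).
Proof.
apply: measurable_fun_rVP => i; case: (unliftP ord0 i) => [j ->|->].
  by under eq_fun do rewrite cons_rVS; exact: measurable_coord_rV.
by under eq_fun do rewrite cons_rV0; exact: measurable_cst.
Qed.

Lemma measurable_integral_cons_rV n (G : 'rV[R]_n.+1 -> \bar R) :
  measurable_fun setT G -> (forall x, 0 <= G x) ->
  measurable_fun [set: 'rV[R]_n]
    (fun y => \int[@lebesgue_measure R]_s G (cons_rV (s, y))).
Proof.
move=> mG G0.
apply: (@measurable_fun_fubini_tonelli_G _ _ (measurableTypeR R) 'rV[R]_n R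
  (@lebesgue_measure R) (fun p => G (cons_rV p))) => //.
apply: (measurableT_comp mG) => _ Y mY.
exact: (@measurable_cons_rV R n measurableT Y mY).
Qed.

Lemma measurable_integral_consr_rV n (G : 'rV[R]_n.+1 -> \bar R) :
  measurable_fun setT G -> (forall x, 0 <= G x) ->
  measurable_fun [set: measurableTypeR R]
    (fun t => \int[lebesgue_rV n]_y G (cons_rV (t, y))).
Proof.
move=> mG G0.
apply: (@measurable_fun_fubini_tonelli_F _ _ (measurableTypeR R) 'rV[R]_n R
  (lebesgue_rV n) (fun p => G (cons_rV p))) => //.
apply: (measurableT_comp mG) => _ Y mY.
exact: (@measurable_cons_rV R n measurableT Y mY).
Qed.

(* The Gagliardo-Nirenberg-Sobolev inequality only uses this consequence of
   G dominating the partial derivatives of the compactly supported f. *)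
Fixpoint line_bounded n :
    ('rV[R]_n -> \bar R) -> ('rV[R]_n -> \bar R) -> Prop :=
  match n with
  | 0 => fun _ _ => True
  | n'.+1 => fun f G =>
      (forall t y, f (cons_rV (t, y)) <=
                   \int[@lebesgue_measure R]_s G (cons_rV (s, y))) /\
      (forall t, line_bounded n' (fun y => f (cons_rV (t, y)))
                                 (fun y => G (cons_rV (t, y))))
  end.

(** In dimension d = n+1 this is the bound of f in L^(d/(d-1)) by the integral of G, written by
    duality against h^(1/d) in L^d. This form still makes sense for d = 1, where the exponent
    d/(d-1) is infinite, and so starts the induction. *)
Definition dual_gagliardo n := forall f G h : 'rV[R]_n.+1 -> \bar R,
  measurable_fun setT f -> measurable_fun setT G -> measurable_fun setT h ->
  (forall x, 0 <= f x) -> (forall x, 0 <= G x) -> (forall x, 0 <= h x) ->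
  line_bounded n.+1 f G ->
  \int[lebesgue_rV n.+1]_x (f x * h x `^ n.+1%:R^-1) <=
  \int[lebesgue_rV n.+1]_x G x * (\int[lebesgue_rV n.+1]_x h x) `^ n.+1%:R^-1.

Definition gagliardo n := forall f G : 'rV[R]_n.+2 -> \bar R,
  measurable_fun setT f -> measurable_fun setT G ->
  (forall x, 0 <= f x) -> (forall x, 0 <= G x) ->
  line_bounded n.+2 f G ->
  \int[lebesgue_rV n.+2]_x (f x `^ (1 + n.+1%:R^-1)) <=
  (\int[lebesgue_rV n.+2]_x G x) `^ (1 + n.+1%:R^-1).

Lemma dual_gagliardo0 : dual_gagliardo 0.
Proof.
move=> f G h mf mG mh f0 G0 h0 [fG _]; rewrite invr1.
rewrite (poweRe1 (integral_ge0 _ _))//.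
have fE x : f x <= \int[lebesgue_rV 1]_x G x.
  (* In dimension 0 the measure is a Dirac mass, so the integral over R^1 is the integral along the
     only line, which bounds f pointwise. *)
  rewrite ge0_integral_rVS21// -[lebesgue_rV 0]/(\d_(0 : 'rV[R]_0)%R).
  rewrite integral_dirac//; last exact: measurable_integral_cons_rV.
  rewrite diracT mul1e (_ : x = cons_rV (x ord0 ord0, (0 : 'rV[R]_0)%R)); first exact: fG.
  apply/rowP => i; case: (unliftP ord0 i) => [[]//|->].
  by rewrite cons_rV0.
rewrite -ge0_integralZl//; last exact: integral_ge0.
apply: ge0_le_integral => //.
- by move=> x _; rewrite mule_ge0// poweR_ge0.
- apply: emeasurable_funM => //.
  exact: (measurableT_comp (measurable_poweR _) mh).
- exact: measurable_funeM.
- by move=> x _; rewrite poweRe1// lee_wpmul2r.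
Qed.

(* f^(1 + 1/(n+1)) <= f h^(1/(n+1)), where h, the integral of G along the first
   axis, does not depend on the first coordinate. *)
Lemma dual_gagliardoP n : dual_gagliardo n -> gagliardo n.
Proof.
move=> dual f G mf mG f0 G0 [fG slices].
set e : R := (n.+1%:R^-1)%R.
have e0 : (0 < e)%R by rewrite invr_gt0.
have pD (x : \bar R) : 0 <= x -> x `^ (1 + e) = x * x `^ e.
  move=> x0; rewrite poweRD ?poweRe1//.
  by rewrite add_neq0_poweRD_def// gt_eqF// addr_gt0.
rewrite [leRHS]pD ?integral_ge0//.
under eq_integral do rewrite pD//.
have mfe : measurable_fun setT (fun x => f x * f x `^ e).
  by apply: emeasurable_funM => //; exact: (measurableT_comp (measurable_poweR _) mf).
have fe0 x : 0 <= f x * f x `^ e by rewrite mule_ge0// poweR_ge0.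
rewrite [leLHS]ge0_integral_rVS12//.
pose h y := \int[@lebesgue_measure R]_s G (cons_rV (s, y)).
have mh : measurable_fun setT h by exact: measurable_integral_cons_rV.
have h0 y : 0 <= h y by exact: integral_ge0.
rewrite [X in _ * X `^ _]ge0_integral_rVS21// -/h.
rewrite [X in X * _]ge0_integral_rVS12//.
rewrite -ge0_integralZr//; last 3 first.
- exact: measurable_integral_consr_rV.
- by move=> t _; exact: integral_ge0.
- exact: poweR_ge0.
apply: ge0_le_integral => //.
- by move=> t _; apply: integral_ge0 => y _; exact: fe0.
- exact: (measurable_integral_consr_rV _ _ mfe fe0).
- apply: emeasurable_funM => //.
  exact: measurable_integral_consr_rV.
move=> t _.
have mc := @measurable_cons_rVr n.+1 t.
have mfc := measurableT_comp mf mc.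
have mGc := measurableT_comp mG mc.
apply: le_trans (dual _ _ h mfc mGc mh _ _ _ (slices t)) => //; first last.
- by move=> y; exact: G0.
- by move=> y; exact: f0.
apply: ge0_le_integral => //.
- exact: (measurableT_comp mfe mc).
- by apply: emeasurable_funM => //; exact: (measurableT_comp (measurable_poweR _) mh).
move=> y _; rewrite lee_wpmul2l//.
by apply: (gt0_ler_poweR (ltW e0)); rewrite ?in_itv/= ?leey ?andbT.
Qed.

(** Hölder with the conjugate exponents d/(d-1) and d, for d = n+2. The dimension is the same on
    both sides; it is [dual_gagliardoP] that raises it. *)
Lemma gagliardo_dual n : gagliardo n -> dual_gagliardo n.+1.
Proof.
move=> gag f G h mf mG mh f0 G0 h0 fG.
set b : R := (n.+2%:R^-1)%R; set c : R := (1 + n.+1%:R^-1)%R.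
have n1 : (0 < n.+1%:R :> R)%R by [].
have b0 : (0 < b)%R by rewrite invr_gt0.
have cb : (c^-1 + b = 1)%R.
  rewrite /c /b -(@natr1 _ n.+1); field.
  by rewrite !gt_eqF// ltr_wpDl.
have c0 : (0 < c)%R by rewrite /c addr_gt0// invr_gt0.
have cV0 : (0 < c^-1)%R by rewrite invr_gt0.
have mpow (k : 'rV[R]_n.+2 -> \bar R) r : measurable_fun setT k ->
    measurable_fun setT (fun x => k x `^ r).
  by move=> mk; exact: (measurableT_comp (measurable_poweR r) mk).
have -> : \int[lebesgue_rV n.+2]_x (f x * h x `^ b) =
    \int[lebesgue_rV n.+2]_x ((f x `^ c) `^ c^-1 * h x `^ b).
  by apply: eq_integral => x _; rewrite -poweRrM mulfV ?poweRe1// gt_eqF.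
apply: le_trans (hoelder_weighted _ _ _ _ _ _ _ _ _ _ _ _ cV0 b0 cb) _ => //.
- exact: mpow.
- by move=> x; exact: poweR_ge0.
rewrite lee_wpmul2r ?poweR_ge0//.
have root (x y : \bar R) : 0 <= x -> 0 <= y -> x <= y `^ c -> x `^ c^-1 <= y.
  move=> x0 y0 xy; rewrite -[leRHS](poweRe1 y0) -(mulfV (lt0r_neq0 c0)) poweRrM.
  by apply: (gt0_ler_poweR (ltW cV0)); rewrite ?in_itv/= ?leey ?andbT// poweR_ge0.
apply: root; last exact: gag.
- by apply: integral_ge0 => x _; exact: poweR_ge0.
- by apply: integral_ge0 => x _; exact: G0.
Qed.

Theorem gagliardo_nirenberg n : gagliardo n.
Proof.
elim: n => [|n ih]; apply: dual_gagliardoP; first exact: dual_gagliardo0.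
exact: gagliardo_dual.
Qed.

End sobolev_slices.

(** * Continuity, topology and measurability on R^n *)

Section pointwise_continuity.
Context {R : realType} {T : topologicalType}.
Implicit Types f g : T -> R.

Lemma continuous_add f g : continuous f -> continuous g ->
  continuous (fun x => f x + g x).
Proof. by move=> cf cg x; exact: cvgD (cf x) (cg x). Qed.

Lemma continuous_mul f g : continuous f -> continuous g ->
  continuous (fun x => f x * g x).
Proof. by move=> cf cg x; exact: cvgM (cf x) (cg x). Qed.

Lemma continuous_fcomp f (g : R -> R) : continuous f -> continuous g ->
  continuous (fun x => g (f x)).
Proof. by move=> cf cg x; exact: continuous_comp (cf x) (cg _). Qed.

Lemma continuous_sum (I : Type) (s : seq I) (F : I -> T -> R) :
  (forall i, continuous (F i)) -> continuous (fun x => \sum_(i <- s) F i x).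
Proof.
move=> cF; elim: s => [|i s ih].
  by under eq_fun do rewrite big_nil; exact: cst_continuous.
by under eq_fun do rewrite big_cons; exact: continuous_add.
Qed.

End pointwise_continuity.

Section rV_topology.
Context {R : realType}.

Lemma continuous_rV {T : topologicalType} n (f : T -> 'rV[R]_n) :
  (forall i, continuous (fun x => f x ord0 i)) -> continuous f.
Proof.
move=> cf x; apply/cvg_ballP => e e0.
have : \forall y \near x, forall i : 'I_n, ball (f x ord0 i) e (f y ord0 i).
  by apply: filter_forall => i; move/cvg_ballP : (cf i x); exact.
by apply: filterS => y fy; split=> // i j; rewrite (ord1 i); exact: fy.
Qed.

Lemma ler_rV_norm n (x : 'rV[R]_n) (M : R) : 0 <= M ->
  (`|x| <= M) <-> (forall i, `|x ord0 i| <= M).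
Proof.
move=> M0; split => [xM i|xM].
  apply: le_trans xM; rewrite [leRHS]/Num.norm/= mx_normrE.
  by apply/bigmax_geP; right => /=; exists (ord0, i).
rewrite [leLHS]/Num.norm/= mx_normrE; apply: bigmax_le => //= -[i j] _ /=.
by rewrite (ord1 i).
Qed.

Lemma norm_coord_le n (x : 'rV[R]_n) i : `|x ord0 i| <= `|x|.
Proof. by move: i; apply/ler_rV_norm. Qed.

(** The sigma-algebra is generated by coordinates, so U is exhausted by the countably many half-open
    cubes with corners in the grid of mesh 1/(k+1) that lie inside U; a point at distance more than
    1/(k+1) from the complement lies in such a cube. *)
Lemma open_measurable_rV n (U : set 'rV[R]_n) : open U -> measurable U.
Proof.
move=> oU.
pose box (zk : 'rV[int]_n * nat) := [set x : 'rV[R]_n | forall i,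
  x ord0 i \in `[(zk.1 ord0 i)%:~R / zk.2.+1%:R,
                 ((zk.1 ord0 i)%:~R + 1) / zk.2.+1%:R[].
pose F zk := if pselect (box zk `<=` U) then box zk else set0.
have -> : U = \bigcup_zk F zk.
  apply/seteqP; split => [x Ux|x [zk _]]; last first.
    by rewrite /F; case: pselect => // boxU; exact: boxU.
  have /nbhs_ballP[e /= e0 eU] : nbhs x U by exact: open_nbhs_nbhs.
  pose k := Num.truncn e^-1.
  have ke : (k.+1%:R)^-1 < e.
    by rewrite invf_plt ?posrE// truncnS_gt.
  pose z := (\row_i Num.floor (x ord0 i * k.+1%:R))%R : 'rV[int]_n.
  have xz : box (z, k) x.
    move=> i; rewrite in_itv/= mxE ler_pdivrMr// ltr_pdivlMr//.
    by rewrite floor_le_tmp -[1]/(1%:~R) -intrD floorD1_gt.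
  exists (z, k) => //; rewrite /F; case: pselect => // -[].
  move=> y yz; apply: eU; split => // i j; rewrite (ord1 i).
  move: (xz j) (yz j); rewrite !in_itv/= mulrDl mul1r.
  move: ((z ord0 j)%:~R / _) => w /andP[wx xw] /andP[wy yw].
  move: xw yw; rewrite /= => xw yw; rewrite /ball/= ltr_norml.
  move: (k.+1%:R^-1) ke xw yw => r ke xw yw.
  by apply/andP; split; lra.
apply: countable_bigcupT_measurable => // zk; rewrite /F.
case: pselect => [boxU|?] /=; last exact: measurable0.
rewrite (_ : box zk = \bigcap_(i in [set: 'I_n]) ((fun y : 'rV[R]_n =>
    y ord0 i) @^-1` [set` `[(zk.1 ord0 i)%:~R / zk.2.+1%:R,
                 ((zk.1 ord0 i)%:~R + 1) / zk.2.+1%:R[])); last first.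
  by apply/seteqP; split => [y yB i _|y yB i]; [exact: yB|exact: (yB i)].
apply: fin_bigcap_measurable => // i _; rewrite -[X in measurable X]setTI.
by apply: measurable_coord_rV => //; exact: measurable_itv.
Qed.

Lemma continuous_measurable_rV n (f : 'rV[R]_n -> R) :
  continuous f -> measurable_fun setT f.
Proof.
move=> /continuousP cf; apply: (measurability _ (RGenOpens.measurableE R)).
move=> _ [_ [a [b ->] <-]]; rewrite setTI; apply: open_measurable_rV.
exact/cf/interval_open.
Qed.

Lemma continuous_cons_rVr n (t : R) :
  continuous (fun y : 'rV[R]_n => cons_rV (t, y)).
Proof.
apply: continuous_rV => i; case: (unliftP ord0 i) => [j ->|->].
  by under eq_fun do rewrite cons_rVS; exact: coord_continuous.
by under eq_fun do rewrite cons_rV0; exact: cst_continuous.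
Qed.

Lemma continuous_cons_rVl n (y : 'rV[R]_n) :
  continuous (fun t : R => cons_rV (t, y)).
Proof.
apply: continuous_rV => i; case: (unliftP ord0 i) => [j ->|->].
  by under eq_fun do rewrite cons_rVS; exact: cst_continuous.
by under eq_fun do rewrite cons_rV0; exact: id.
Qed.

Lemma norm_cons_rVl n (t : R) (y : 'rV[R]_n) : `|t| <= `|cons_rV (t, y)|.
Proof. by have := norm_coord_le _ (cons_rV (t, y)) ord0; rewrite cons_rV0. Qed.

Lemma norm_cons_rVr n (t : R) (y : 'rV[R]_n) : `|y| <= `|cons_rV (t, y)|.
Proof.
apply/ler_rV_norm => // i.
by have := norm_coord_le _ (cons_rV (t, y)) (lift ord0 i); rewrite cons_rVS.
Qed.

End rV_topology.

(** * Continuous functions of compact support and their integrability *)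

Section compact_support.
Context {R : realType} {n : nat}.
Implicit Types f g : 'rV[R]_n -> R.

Definition vanish_outside (M : R) f := forall x, M < `|x| -> f x = 0.

(** Compact support is expressed by a bound in the sup norm, so that the support sits in a cube of
    known Lebesgue measure. *)
Definition Cc f := continuous f /\ exists M, vanish_outside M f.

Lemma Cc_continuous f : Cc f -> continuous f. Proof. by case. Qed.

Lemma Cc_measurable f : Cc f -> measurable_fun setT f.
Proof. by case=> cf _; exact: continuous_measurable_rV. Qed.

Lemma Cc_bounded f : Cc f -> exists2 B, 0 <= B & forall x, `|f x| <= B.
Proof.
move=> [cf [M fM]].
have K : compact [set x : 'rV[R]_n | `|x| <= `|M|].
  apply: bounded_closed_compact.
    exists `|M|; split; first exact: num_real.
    by move=> r Mr x /= /le_trans; apply; exact: ltW.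
  apply: (@closed_comp _ _ (fun x : 'rV[R]_n => `|x|) [set r | r <= `|M|]).
    by move=> x _; exact: norm_continuous.
  exact: closed_le.
have /compact_bounded[B [_ fB]] := continuous_compact (continuous_subspaceT cf) K.
exists (`|B| + 1) => [|x]; first by rewrite addr_ge0.
have [xM|Mx] := leP `|x| `|M|.
  by apply: (fB (`|B| + 1)) => /=; [rewrite (le_lt_trans (ler_norm _))// ltrDl|exists x].
by rewrite fM ?normr0 ?addr_ge0// (le_lt_trans (ler_norm _) Mx).
Qed.

Lemma lebesgue_rV_cube (M : R) : 0 <= M ->
  lebesgue_rV n [set x : 'rV[R]_n | `|x| <= M] = ((2 * M) ^+ n)%:E.
Proof.
move=> M0.
have -> : [set x : 'rV[R]_n | `|x| <= M] = [set x | forall i,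
    x ord0 i \in `[(const_mx (- M) : 'rV[R]_n) ord0 i,
                   (const_mx M : 'rV[R]_n) ord0 i]].
  apply/seteqP; split => x /=; rewrite ler_rV_norm// => xM i.
    by rewrite !mxE in_itv/= -ler_norml.
  by have := xM i; rewrite !mxE in_itv/= -ler_norml.
rewrite lebesgue_rV_box => [|i]; last by rewrite !mxE ge0_cp.
under eq_bigr do rewrite !mxE opprK.
by rewrite prodr_const card_ord mulr2n mulrDl mul1r.
Qed.

Lemma measurable_cube (M : R) : measurable [set x : 'rV[R]_n | `|x| <= M].
Proof.
rewrite (_ : [set x | _] = ~` [set x : 'rV[R]_n | M < `|x|]); last first.
  apply/seteqP; split => x /=; first by move=> xM; rewrite ltNge xM.
  by move/negP; rewrite -leNgt.
apply: measurableC; apply: open_measurable_rV.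
apply: (@open_comp _ _ (fun x : 'rV[R]_n => `|x|) [set r | M < r]).
  by move=> x _; exact: norm_continuous.
exact: open_gt.
Qed.

Lemma le_integral_cube (f : 'rV[R]_n -> R) (B M : R) : 0 <= B -> 0 <= M ->
  measurable_fun setT f -> (forall x, 0 <= f x) -> (forall x, f x <= B) ->
  vanish_outside M f ->
  (\int[lebesgue_rV n]_x (f x)%:E <= (B * (2 * M) ^+ n)%:E)%E.
Proof.
move=> B0 M0 mf f0 fB fM.
pose K := [set x : 'rV[R]_n | `|x| <= M].
have -> : (\int[lebesgue_rV n]_x (f x)%:E =
    \int[lebesgue_rV n]_(x in K) (f x)%:E)%E.
  rewrite [RHS]integral_mkcond; apply: eq_integral => x _.
  rewrite patchE; case: ifPn => // /negP; rewrite inE/= => /negP.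
  by rewrite -ltNge => /fM ->.
rewrite EFinM -lebesgue_rV_cube// -integral_cst//; last exact: measurable_cube.
apply: ge0_le_integral => //=.
- exact: measurable_cube.
- by move=> x _; rewrite lee_fin.
- by apply/measurable_EFinP; exact: measurable_funS mf.
- by move=> x _; rewrite lee_fin.
Qed.

Lemma Cc_integrable f : Cc f -> (lebesgue_rV n).-integrable setT (EFin \o f).
Proof.
move=> cf; have [B B0 fB] := Cc_bounded _ cf.
have mf := Cc_measurable _ cf.
apply/integrableP; split; first exact/measurable_EFinP.
case: cf => _ [M fM].
apply: (@le_lt_trans _ _ (B * (2 * `|M|) ^+ n)%:E); last exact: ltry.
apply: (le_integral_cube (fun x => `|f x|)) => //.
- exact: measurableT_comp.
- by move=> x Mx; rewrite fM ?normr0// (le_lt_trans (ler_norm _) Mx).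
Qed.

End compact_support.

(** * C^1 functions with explicit gradients *)

Section has_grad.
Context {R : realType}.

(** Turns a directional derivative into a derivative at 0 of a function of one real variable, to
    which the chain rule [is_derive1_comp] applies. *)
Lemma is_derive_line {V W : normedModType R} (f : V -> W) (x v : V) (d : W) :
  is_derive x v f d <-> is_derive (0 : R) 1 (fun h : R => f (h *: v + x)) d.
Proof.
have E : 'D_v f x = 'D_1 (fun h : R => f (h *: v + x)) 0.
  rewrite /derive; set g1 := fun h => h^-1 *: _; set g2 := fun h => h^-1 *: _.
  suff -> : g1 = g2 by []; apply/funext => h; rewrite /g1 /g2/=.
  by rewrite addr0 scale0r add0r [_%:A]mulr1.
split=> -[df dE]; split.
- exact: (derivable1P f x v).1.
- by rewrite -E.
- exact: (derivable1P f x v).2.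
- by rewrite E.
Qed.

Lemma coord_line {n} (h : R) (i j : 'I_n) (x : 'rV[R]_n) :
  (h *: delta_mx ord0 i + x) ord0 j = h * (j == i)%:R + x ord0 j.
Proof. by rewrite !mxE eqxx. Qed.

(** The gradient is carried as data rather than as [partial i f], so that product and chain rules
    produce formulas on which [ring] and [field] can work. *)
Definition has_grad n (f : 'rV[R]_n -> R) (df : 'I_n -> 'rV[R]_n -> R) :=
  continuous f /\ forall i, continuous (df i) /\
    forall x, is_derive x (delta_mx ord0 i : 'rV[R]_n) f (df i x).

Context {n : nat}.
Implicit Types (f g : 'rV[R]_n -> R) (df dg : 'I_n -> 'rV[R]_n -> R).

Lemma has_grad_continuous f df : has_grad n f df -> continuous f.
Proof. by case. Qed.

Lemma has_grad_dcontinuous f df i : has_grad n f df -> continuous (df i).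
Proof. by case=> _ /(_ i)[]. Qed.

Lemma has_grad_cst (c : R) : has_grad n (fun=> c) (fun _ _ => 0).
Proof.
split=> [|i]; first exact: cst_continuous.
by split=> [|x]; [exact: cst_continuous|exact: is_derive_cst].
Qed.

Lemma has_grad_coord (j : 'I_n) :
  has_grad n (fun x => x ord0 j) (fun i _ => (i == j)%:R).
Proof.
split=> [|i]; first exact: coord_continuous.
split=> [|x]; first exact: cst_continuous.
apply/is_derive_line.
rewrite (_ : (fun h : R => _) = (fun h : R => (i == j)%:R * h + x ord0 j)); last first.
  by apply/funext => h; rewrite coord_line mulrC eq_sym.
apply: is_derive_eq; rewrite addr0.
by rewrite [in LHS]/GRing.scale/= ?mulr1 ?scaler0 ?addr0 ?mulr0 ?add0r.
Qed.

Lemma has_gradD f g df dg : has_grad n f df -> has_grad n g dg ->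
  has_grad n (fun x => f x + g x) (fun i x => df i x + dg i x).
Proof.
move=> [cf Df] [cg Dg]; split=> [x|i]; first exact: cvgD (cf x) (cg x).
have [cdf {}Df] := Df i; have [cdg {}Dg] := Dg i.
split=> x; first exact: cvgD (cdf x) (cdg x).
exact: is_deriveD.
Qed.

Lemma has_gradM f g df dg : has_grad n f df -> has_grad n g dg ->
  has_grad n (fun x => f x * g x) (fun i x => df i x * g x + f x * dg i x).
Proof.
move=> [cf Df] [cg Dg]; split=> [x|i]; first exact: cvgM (cf x) (cg x).
have [cdf {}Df] := Df i; have [cdg {}Dg] := Dg i.
split=> x.
  exact: cvgD (cvgM (cdf x) (cg x)) (cvgM (cf x) (cdg x)).
apply: is_derive_eq (is_deriveM (Df x) (Dg x)) _.
by rewrite addrC mulrC.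
Qed.

Lemma has_grad_sum (I : Type) (s : seq I) (F : I -> 'rV[R]_n -> R) dF :
  (forall j, has_grad n (F j) (dF j)) ->
  has_grad n (fun x => \sum_(j <- s) F j x) (fun i x => \sum_(j <- s) dF j i x).
Proof.
move=> HF; elim: s => [|j s ih].
  have := has_grad_cst 0; congr has_grad.
    by apply/funext => x; rewrite big_nil.
  by apply/funext => i; apply/funext => x; rewrite big_nil.
have := has_gradD _ _ _ _ (HF j) ih; congr has_grad.
  by apply/funext => x; rewrite big_cons.
by apply/funext => i; apply/funext => x; rewrite big_cons.
Qed.

Lemma has_grad_comp f df (g g' : R -> R) : has_grad n f df ->
  (forall x, {for f x, continuous g'}) ->
  (forall x, is_derive (f x) 1 g (g' (f x))) ->
  has_grad n (fun x => g (f x)) (fun i x => g' (f x) * df i x).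
Proof.
move=> [cf Df] cg' Dg; split=> [x|i].
  apply: (continuous_comp (cf x)).
  apply/differentiable_continuous/derivable1_diffP.
  by have [] := Dg x.
have [cdf {}Df] := Df i; split=> x.
  exact: cvgM (continuous_comp (cf x) (cg' x)) (cdf x).
apply/is_derive_line; apply: (@is_derive1_comp _ g (fun h : R => f (h *: _ + x))).
  by rewrite scale0r add0r.
exact: ((is_derive_line f x _ _).1 (Df x)).
Qed.

Lemma has_grad_vanish f df M i : has_grad n f df -> vanish_outside M f ->
  vanish_outside M (df i).
Proof.
move=> [_ /(_ i)[_ Df]] fM x Mx.
have [_ <-] := Df x.
rewrite (@near_eq_derive _ _ _ _ (cst 0)) ?derive_cst//.
have : nbhs x [set y : 'rV[R]_n | M < `|y|].
  apply: open_nbhs_nbhs; split => //.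
  apply: (@open_comp _ _ (fun x : 'rV[R]_n => `|x|) [set r | M < r]).
    by move=> y _; exact: norm_continuous.
  exact: open_gt.
by apply: filterS => y /fM.
Qed.

End has_grad.
Arguments has_grad {R n}.

(** * Slices, the fundamental theorem of calculus and the divergence theorem *)

Section grad_slices.
Context {R : realType} {n : nat}.
Variables (f : 'rV[R]_n.+1 -> R) (df : 'I_n.+1 -> 'rV[R]_n.+1 -> R).
Hypothesis fdf : has_grad f df.

Lemma has_grad_consr (t : R) : has_grad (fun y => f (cons_rV (t, y)))
  (fun i y => df (lift ord0 i) (cons_rV (t, y))).
Proof.
have [cf Df] := fdf; have cc := @continuous_cons_rVr R n t.
split=> [y|i]; first exact: (continuous_comp (cc y) (cf _)).
have [cdf {}Df] := Df (lift ord0 i); split=> y.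
  exact: (continuous_comp (cc y) (cdf _)).
apply/is_derive_line; have /is_derive_line := Df (cons_rV (t, y)).
congr is_derive; apply/funext => h; congr f.
apply/rowP => j; case: (unliftP ord0 j) => [k ->|->].
  by rewrite coord_line !cons_rVS coord_line (inj_eq lift_inj).
by rewrite coord_line !cons_rV0 eq_liftF mulr0 add0r.
Qed.

Lemma is_derive_consl (y : 'rV[R]_n) (t : R) :
  is_derive t 1 (fun s => f (cons_rV (s, y))) (df ord0 (cons_rV (t, y))).
Proof.
have [cf /(_ ord0)[_ Df]] := fdf.
apply/is_derive_line; have /is_derive_line := Df (cons_rV (t, y)).
congr is_derive; apply/funext => h; congr f.
apply/rowP => j; case: (unliftP ord0 j) => [k ->|->].
  by rewrite coord_line !cons_rVS eq_sym eq_liftF mulr0 add0r.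
by rewrite coord_line !cons_rV0 eqxx.
Qed.

Lemma continuous_consl i (y : 'rV[R]_n) :
  continuous (fun s => df i (cons_rV (s, y))).
Proof.
have [_ /(_ i)[cdf _]] := fdf => s.
exact: (continuous_comp (@continuous_cons_rVl R n y s) (cdf _)).
Qed.

End grad_slices.

Section one_dimensional.
Context {R : realType}.
Variables (g dg : R -> R) (M : R).
Hypothesis cdg : continuous dg.
Hypothesis Dg : forall t : R, is_derive t 1 g (dg t).
Hypothesis gM : forall t, M < `|t| -> g t = 0.
Hypothesis dgM : forall t, M < `|t| -> dg t = 0.
Local Notation mu := lebesgue_measure.

Let FTC a b : a < b -> (\int[mu]_(t in `[a, b]) (dg t)%:E = (g b - g a)%:E)%E.
Proof.
have cg : continuous g.
  by move=> t; apply/differentiable_continuous/derivable1_diffP; have [] := Dg t.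
move=> ab; rewrite EFinB (@continuous_FTC2 _ dg g a b ab)//.
- exact: continuous_subspaceT.
- split.
  + by move=> t _; have [] := Dg t.
  + exact: cvg_at_right_filter (cg a).
  + exact: cvg_at_left_filter (cg b).
- by move=> t _; rewrite derive1E; have [_ ->] := Dg t.
Qed.

Let K := `|M| + 1.
Let K0 : 0 < K. Proof. by rewrite /K ltr_wpDl. Qed.
Let MK : M < K. Proof. by rewrite (le_lt_trans (ler_norm _))// ltrDl. Qed.

Lemma integral_derive_eq0 : (\int[mu]_t (dg t)%:E = 0)%E.
Proof.
have -> : (\int[mu]_t (dg t)%:E = \int[mu]_(t in `[(- K)%R, K]) (dg t)%:E)%E.
  rewrite [RHS]integral_mkcond; apply: eq_integral => t _; rewrite patchE.
  case: ifPn => // /negP; rewrite inE/= in_itv/= -ler_norml => /negP.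
  by rewrite -ltNge => Kt; rewrite dgM// (lt_trans MK).
have gK t : `|t| = K -> g t = 0 by move=> tK; rewrite gM// tK.
rewrite FTC; last by rewrite gt0_cp.
by rewrite !gK ?subrr ?normrN// gtr0_norm.
Qed.

Lemma le_norm_integral_derive t : (`|g t|%:E <= \int[mu]_s `|dg s|%:E)%E.
Proof.
have cnd : continuous (fun s => `|dg s|).
  by move=> s; apply: (continuous_comp (cdg s)); exact: norm_continuous.
have mnd : measurable_fun setT (fun s => `|dg s|%:E).
  by apply/measurable_EFinP; exact: continuous_measurable_fun.
have [tK|Kt] := ltP (- K) t; last first.
  rewrite gM ?normr0; first by apply: integral_ge0 => s _; rewrite lee_fin.
  by apply: (lt_le_trans MK); rewrite ler_normr; apply/orP; right; rewrite lerNr.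
have gK : g (- K) = 0 by rewrite gM// normrN gtr0_norm.
have := FTC _ _ tK; rewrite gK subr0 => gE.
rewrite -[leLHS]/(`|(g t)%:E|)%E -gE.
apply: le_trans (le_abse_integral _ _ _) _ => //.
  by apply/measurable_EFinP; apply: measurable_funTS; exact: continuous_measurable_fun.
by apply: ge0_subset_integral => //= s _; rewrite lee_fin.
Qed.

End one_dimensional.

Section divergence_theorem.
Context {R : realType}.

(** Induction on the dimension: for the first direction the inner integral along that axis vanishes
    by the fundamental theorem; any other direction is a direction of the slices orthogonal to the
    first axis. *)
Lemma integral_grad_eq0 n (f : 'rV[R]_n -> R) df M i :
  has_grad f df -> vanish_outside M f ->
  (\int[lebesgue_rV n]_x (df i x)%:E = 0)%E.
Proof.
elim: n f df i => [f df []//|n ih f df i] fdf fM.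
have Ci : Cc (df i).
  split; first exact: has_grad_dcontinuous fdf.
  by exists M; exact: has_grad_vanish fdf fM.
have := Cc_integrable _ Ci; rewrite /comp => Ii.
case: (unliftP ord0 i) => [j ij|i0].
  rewrite integral_rVS12// -[RHS](integral0 lebesgue_measure setT).
  apply: eq_integral => t _; rewrite ij.
  apply: (ih _ _ _ (has_grad_consr _ _ fdf t)).
  by move=> y My; apply: fM; apply: lt_le_trans (norm_cons_rVr _ _ _).
rewrite integral_rVS21// -[RHS](integral0 (lebesgue_rV n) setT).
apply: eq_integral => y _; rewrite i0.
apply: (@integral_derive_eq0 _ (fun s => f (cons_rV (s, y)))
  (fun s => df ord0 (cons_rV (s, y))) M).
- exact: continuous_consl fdf _ _.
- exact: is_derive_consl.
- by move=> t Mt; apply: fM; apply: lt_le_trans (norm_cons_rVl _ _ _).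
- move=> t Mt; apply: (has_grad_vanish _ _ _ _ fdf fM).
  by apply: lt_le_trans (norm_cons_rVl _ _ _).
Qed.

(** Connects the abstract hypothesis of the Gagliardo inequality with calculus: on a line along the
    first axis |f| is at most the integral of its derivative, and G keeps dominating the derivatives
    of the slices. *)
Lemma has_grad_line_bounded n (f : 'rV[R]_n -> R) df M (G : 'rV[R]_n -> R) :
  has_grad f df -> vanish_outside M f -> continuous G ->
  (forall i x, `|df i x| <= G x) ->
  line_bounded n (fun x => `|f x|%:E) (fun x => (G x)%:E).
Proof.
elim: n f df G => // n ih f df G fdf fM cG dfG; split=> [t y|t] /=; last first.
  have cc := @continuous_cons_rVr R n t.
  apply: (ih _ _ _ (has_grad_consr _ _ fdf t)).
  - by move=> y My; apply: fM; apply: lt_le_trans (norm_cons_rVr _ _ _).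
  - by move=> y; exact: (continuous_comp (cc y) (cG _)).
  - by move=> i y; exact: dfG.
apply: (@le_trans _ _ (\int[lebesgue_measure]_s `|df ord0 (cons_rV (s, y))|%:E)%E).
  apply: (@le_norm_integral_derive _ (fun s => f (cons_rV (s, y)))
    (fun s => df ord0 (cons_rV (s, y))) M).
  - exact: continuous_consl fdf _ _.
  - exact: is_derive_consl.
  - by move=> s Ms; apply: fM; apply: lt_le_trans (norm_cons_rVl _ _ _).
apply: ge0_le_integral => //.
- apply/measurable_EFinP; apply: continuous_measurable_fun => s.
  apply: (@continuous_comp _ _ _ (fun s => df ord0 (cons_rV (s, y))) Num.norm).
    exact: continuous_consl fdf _ _ _.
  exact: norm_continuous.
- apply/measurable_EFinP; apply: continuous_measurable_fun => s.
  exact: (continuous_comp (@continuous_cons_rVl R n y s) (cG _)).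
- by move=> s _; rewrite lee_fin.
Qed.

End divergence_theorem.

(** * Real powers as C^1 functions *)

Section positive_power.
Context {R : realType}.
Implicit Types (a b t : R).

(* The truncation at 0 avoids the junk value 1 of powR on negative reals. *)
Definition ppow a t : R := Num.max 0 t `^ a.

Lemma ppow_ge0 a t : 0 <= ppow a t. Proof. exact: powR_ge0. Qed.

Lemma ppow_pos a t : 0 <= t -> ppow a t = t `^ a.
Proof. by move=> t0; rewrite /ppow max_r. Qed.

Lemma ppow_neg a t : a != 0 -> t <= 0 -> ppow a t = 0.
Proof. by move=> a0 t0; rewrite /ppow max_l// powR0. Qed.

Lemma ppow1 t : ppow 1 t = Num.max 0 t.
Proof. by rewrite /ppow powRr1// le_max lexx. Qed.

Lemma ppow2 t : ppow 2 t = Num.max 0 t ^+ 2.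
Proof. by rewrite /ppow powR_mulrn// le_max lexx. Qed.

Lemma le_ppow a s t : 0 <= a -> s <= t -> ppow a s <= ppow a t.
Proof.
move=> a0 st; rewrite /ppow; apply: (ge0_ler_powR a0).
- by rewrite nnegrE le_max lexx.
- by rewrite nnegrE le_max lexx.
- exact: le_max2.
Qed.

Let ppow_near_pos a t : 0 < t -> \near t, powR t a = ppow a t.
Proof.
by move=> t0; near=> s; rewrite ppow_pos// ltW//; near: s; exact: lt_nbhsr.
Unshelve. all: by end_near. Qed.

Let ppow_near_neg a t : a != 0 -> t < 0 -> \near t, 0 = ppow a t.
Proof.
move=> a0 t0; near=> s; rewrite ppow_neg// ltW//; near: s; exact: lt_nbhsl.
Unshelve. all: by end_near. Qed.

Let is_derive_ppow_pos a t : 0 < t ->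
  is_derive t 1 (ppow a) (a * ppow (a - 1) t).
Proof.
move=> t0; rewrite ppow_pos ?ltW//.
apply: near_eq_is_derive (ppow_near_pos _ _ t0) _.
exact: is_derive1_powR.
Qed.

Lemma continuous_ppow a : 0 < a -> continuous (ppow a).
Proof.
move=> a0 t; have [->|] := eqVneq t 0; last first.
  rewrite neq_lt => /orP[t0|t0].
    rewrite /continuous_at ppow_neg ?gt_eqF//; last exact: ltW.
    apply: cvg_trans (near_eq_cvg (ppow_near_neg _ _ (lt0r_neq0 a0) t0)) _.
    exact: cvg_cst.
  apply/differentiable_continuous/derivable1_diffP.
  by have [] := is_derive_ppow_pos a t t0.
rewrite /continuous_at ppow_neg ?gt_eqF//; apply/cvgrPdist_lt => e e0; near=> s.
rewrite sub0r normrN ger0_norm ?ppow_ge0//.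
have [s0|s0] := leP s 0; first by rewrite ppow_neg// gt_eqF.
rewrite ppow_pos ?ltW// -(powRr1 (ltW e0)) -(mulVf (lt0r_neq0 a0)) powRrM.
apply: gt0_ltr_powR; rewrite ?nnegrE ?powR_ge0//; first exact: ltW.
have : `|0 - s| < e `^ a^-1.
  by near: s; apply: (@cvgr_dist_lt _ _ _ _ _ id 0); rewrite ?powR_gt0.
by rewrite sub0r normrN gtr0_norm.
Unshelve. all: by end_near. Qed.

Lemma is_derive_ppow a t : 1 < a ->
  is_derive t 1 (ppow a) (a * ppow (a - 1) t).
Proof.
move=> a1; have a10 : 0 < a - 1 by rewrite subr_gt0.
have a0 : a != 0 by rewrite gt_eqF// (lt_trans _ a1).
have [->|] := eqVneq t 0; last first.
  rewrite neq_lt => /orP[t0|]; last exact: is_derive_ppow_pos.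
  rewrite ppow_neg ?gt_eqF ?ltW// mulr0.
  apply: near_eq_is_derive (ppow_near_neg _ _ a0 t0) _; exact: is_derive_cst.
rewrite (_ : a * ppow (a - 1) 0 = 0); last by rewrite ppow_neg ?mulr0 ?gt_eqF.
(* At 0 the difference quotient is [ppow (a - 1) h], which tends to 0 because a > 1. *)
have cvg0 : (fun h : R => h^-1 *: ((ppow a \o shift 0) (h *: 1) - ppow a 0))
    @ (0 : R)^' --> (0 : R).
  rewrite (ppow_neg a)//.
  apply: (@cvg_trans _ (ppow (a - 1) @ (0 : R)^')); last first.
    have := continuous_ppow _ a10 0; rewrite /continuous_at ppow_neg ?gt_eqF//.
    exact: cvg_within_filter.
  apply: near_eq_cvg; near=> h; rewrite /= subr0 addr0 [h *: 1]mulr1.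
  have h0 : h != 0 by near: h; exact: nbhs_dnbhs_neq.
  have [hn|hp] := leP h 0.
    by rewrite (ppow_neg a)// (ppow_neg (a - 1)) ?scaler0 ?(gt_eqF a10).
  rewrite !ppow_pos ?ltW// powRB ?powRr1 ?ltW//; last by rewrite h0 implybT.
  by rewrite [_ *: _]mulrC.
split; first by apply/cvg_ex; exists 0.
exact: cvg_lim.
Unshelve. all: by end_near. Qed.

Definition npow a t : R := `|t| `^ a.

(* sgn(t) |t|^a *)
Definition spow a t : R := ppow a t - ppow a (- t).

(** Writing even and odd powers through the one-sided power leaves a single function whose
    derivative at 0 has to be computed. *)
Lemma npowE a t : a != 0 -> npow a t = ppow a t + ppow a (- t).
Proof.
move=> a0; have [t0|t0] := leP 0 t.
  by rewrite (ppow_neg _ (- t)) ?oppr_le0// addr0 ppow_pos// /npow ger0_norm.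
rewrite (ppow_neg _ t) ?ltW// add0r ppow_pos ?oppr_ge0 ?ltW//.
by rewrite /npow ltr0_norm.
Qed.

Lemma norm_spow a t : a != 0 -> `|spow a t| = npow a t.
Proof.
move=> a0; rewrite /spow npowE//; have [t0|t0] := leP 0 t.
  rewrite (ppow_neg _ (- t)) ?oppr_le0// addr0 subr0.
  by rewrite ger0_norm ?ppow_ge0.
rewrite (ppow_neg _ t) ?ltW// !add0r normrN.
by rewrite ger0_norm ?ppow_ge0.
Qed.

Lemma npow_ge0 a t : 0 <= npow a t. Proof. exact: powR_ge0. Qed.

Lemma npow0 a : a != 0 -> npow a 0 = 0.
Proof. by move=> a0; rewrite /npow normr0 powR0. Qed.

Lemma npowD a b t : a + b != 0 -> npow (a + b) t = npow a t * npow b t.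
Proof. by move=> ab; rewrite /npow powRD// (negbTE ab). Qed.

Lemma npow2 t : npow 2 t = t ^+ 2.
Proof. by rewrite /npow powR_mulrn// real_normK ?num_real. Qed.

Lemma spow_sqr a t : a != 0 -> spow a t ^+ 2 = npow (a + a) t.
Proof.
move=> a0; rewrite -(real_normK (num_real _)) norm_spow// expr2 -npowD//.
by rewrite -mulr2n mulrn_eq0.
Qed.

Let is_derive_ppowN a t : 1 < a ->
  is_derive t 1 (fun s => ppow a (- s)) (- (a * ppow (a - 1) (- t))).
Proof.
move=> a1; have DN : is_derive t 1 (fun s : R => - s) (- 1).
  exact: (is_deriveN (is_derive_id t 1)).
apply: is_derive_eq (is_derive1_comp (is_derive_ppow a (- t) a1) DN) _.
by rewrite mulrN1.
Qed.

Lemma is_derive_npow a t : 1 < a -> is_derive t 1 (npow a) (a * spow (a - 1) t).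
Proof.
move=> a1; have a0 : a != 0 by rewrite gt_eqF// (lt_trans _ a1).
rewrite (_ : npow a = (fun s => ppow a s + ppow a (- s))); last first.
  by apply/funext => s; rewrite npowE.
rewrite /spow mulrBr.
exact: (is_deriveD (is_derive_ppow _ t a1) (is_derive_ppowN _ t a1)).
Qed.

Lemma is_derive_spow a t : 1 < a -> is_derive t 1 (spow a) (a * npow (a - 1) t).
Proof.
move=> a1; rewrite npowE; last by rewrite subr_eq0 gt_eqF.
rewrite mulrDr -[X in _ + X]opprK.
exact: (is_deriveB (is_derive_ppow _ t a1) (is_derive_ppowN _ t a1)).
Qed.

Let continuous_ppowN a : 0 < a -> continuous (fun t => ppow a (- t)).
Proof.
move=> a0 t; apply: (@continuous_comp _ _ _ -%R (ppow a)).
  exact: opp_continuous.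
exact: continuous_ppow.
Qed.

Lemma continuous_npow a : 0 < a -> continuous (npow a).
Proof.
move=> a0.
rewrite (_ : npow a = (fun s => ppow a s + ppow a (- s))); last first.
  by apply/funext => s; rewrite npowE// gt_eqF.
by move=> t; exact: (cvgD (continuous_ppow _ a0 t) (continuous_ppowN _ a0 t)).
Qed.

Lemma continuous_spow a : 0 < a -> continuous (spow a).
Proof.
by move=> a0 t; exact: (cvgB (continuous_ppow _ a0 t) (continuous_ppowN _ a0 t)).
Qed.

End positive_power.

(** * Regularized weights and cutoffs *)

Section weights.
Context {R : realType}.
Implicit Types (e a b t : R).

(* A C^1 function which is positive everywhere and equal to t for e <= t: powers
   of hreg e (|x|^2) are C^1 on the whole space and agree with powers of |x| away
   from the origin. *)
Definition hreg e t : R := t + ppow 2 (e - t) / e.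
Definition dhreg e t : R := 1 - 2 * ppow 1 (e - t) / e.

Lemma hregE e t : e <= t -> hreg e t = t.
Proof. by move=> et; rewrite /hreg ppow_neg ?subr_le0// mul0r addr0. Qed.

Lemma dhregE e t : e <= t -> dhreg e t = 1.
Proof. by move=> et; rewrite /dhreg ppow_neg ?subr_le0// mulr0 mul0r subr0. Qed.

Lemma hreg_gt0 e t : 0 < e -> 0 < hreg e t.
Proof.
move=> e0; have [et|te] := leP e t; first by rewrite hregE// (lt_le_trans e0).
rewrite /hreg ppow2 max_r ?subr_ge0 ?ltW//.
have -> : t + (e - t) ^+ 2 / e = ((t - e / 2) ^+ 2 + 3 / 4 * e ^+ 2) / e.
  by field; rewrite gt_eqF.
by rewrite divr_gt0// ltr_wpDl ?sqr_ge0// mulr_gt0 ?exprn_gt0.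
Qed.

Lemma is_derive_sub_ppow e t : is_derive t 1 (fun s => ppow 2 (e - s))
  (- (2 * ppow 1 (e - t))).
Proof.
have DN : is_derive t 1 (fun s : R => e - s) (- 1).
  apply: is_derive_eq (is_deriveB (is_derive_cst e t 1) (is_derive_id t 1)) _.
  by rewrite sub0r.
have lt12 : 1 < 2 :> R by rewrite ltr1n.
apply: is_derive_eq (is_derive1_comp (f := ppow 2) (g := fun s => e - s)
  (is_derive_ppow 2 (e - t) lt12) DN) _.
by rewrite mulrN1 -(natrB _ (isT : (1 <= 2)%N)).
Qed.

Lemma continuous_sub_ppow e a : 0 < a -> continuous (fun s => ppow a (e - s)).
Proof.
move=> a0 t; apply: (@continuous_comp _ _ _ (fun s => e - s) (ppow a)).
  exact: (cvgB (cvg_cst e) cvg_id).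
exact: continuous_ppow.
Qed.

Lemma is_derive_hreg e t : is_derive t 1 (hreg e) (dhreg e t).
Proof.
apply: is_derive_eq (is_deriveD (is_derive_id t 1)
  (is_deriveM (is_derive_sub_ppow e t) (is_derive_cst e^-1 t 1))) _.
by rewrite scaler0 add0r /dhreg [_ *: _]mulrC mulNr.
Qed.

Lemma continuous_dhreg e : continuous (dhreg e).
Proof.
move=> t; apply: cvgB; first exact: cvg_cst.
apply: cvgM; last exact: cvg_cst.
by apply: cvgM; [exact: cvg_cst|exact: continuous_sub_ppow].
Qed.

(** Nesting two truncated squares gives a C^1 nondecreasing transition from 0 on t <= 1 to 1 on t >=
    2, with an elementary derivative. *)
Definition theta t : R := ppow 2 (1 - ppow 2 (2 - t)).
Definition dtheta t : R := 2 * ppow 1 (1 - ppow 2 (2 - t)) * (2 * ppow 1 (2 - t)).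

Let ppow2_ge1 t : t <= 1 -> 1 <= ppow 2 (2 - t).
Proof.
move=> t1; rewrite ppow2 max_r; last by rewrite subr_ge0 (le_trans t1)// ler1n.
by rewrite exprn_ege1//; lra.
Qed.

Lemma theta_ge0 t : 0 <= theta t. Proof. exact: ppow_ge0. Qed.

Lemma theta_le1 t : theta t <= 1.
Proof.
rewrite /theta ppow2 exprn_ile1//; first by rewrite le_max lexx.
by rewrite ge_max ler01/= gerBl ppow_ge0.
Qed.

Lemma theta0 t : t <= 1 -> theta t = 0.
Proof. by move=> t1; rewrite /theta ppow_neg// subr_le0 ppow2_ge1. Qed.

Lemma theta1 t : 2 <= t -> theta t = 1.
Proof.
move=> t2; rewrite /theta (ppow_neg 2 (2 - t)) ?subr_le0// subr0.
by rewrite ppow_pos// powR1.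
Qed.

Lemma le_theta s t : s <= t -> theta s <= theta t.
Proof. by move=> st; apply: le_ppow => //; rewrite lerB// le_ppow// lerB. Qed.

Lemma dtheta_ge0 t : 0 <= dtheta t.
Proof. by rewrite !mulr_ge0 ?ppow_ge0. Qed.

Lemma dtheta0 t : t <= 1 \/ 2 <= t -> dtheta t = 0.
Proof.
case=> t1; rewrite /dtheta.
  by rewrite (ppow_neg 1 (1 - _)) ?mulr0 ?mul0r// subr_le0 ppow2_ge1.
by rewrite (ppow_neg 1 (2 - _)) ?subr_le0// !mulr0.
Qed.

Lemma dtheta_le4 t : dtheta t <= 4.
Proof.
have [t1|t1] := leP t 1; first by rewrite dtheta0//; left.
have p1 : ppow 1 (1 - ppow 2 (2 - t)) <= 1.
  by rewrite ppow1 ge_max ler01/= gerBl ppow_ge0.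
have p2 : ppow 1 (2 - t) <= 1.
  by rewrite ppow1 ge_max ler01/= lerBlDl -lerBlDr; lra.
have := ppow_ge0 1 (1 - ppow 2 (2 - t)); have := ppow_ge0 1 (2 - t).
rewrite /dtheta; nra.
Qed.

Lemma is_derive_theta t : is_derive t 1 theta (dtheta t).
Proof.
have := is_derive1_comp (f := fun s => ppow 2 (1 - s)) (g := fun s => ppow 2 (2 - s))
  (is_derive_sub_ppow 1 (ppow 2 (2 - t)))
  (is_derive_sub_ppow 2 t).
by rewrite mulrNN.
Qed.

Lemma continuous_dtheta : continuous dtheta.
Proof.
have k2 : continuous (fun _ : R => 2 : R) by exact: cst_continuous.
have c1 : continuous (fun s : R => ppow 1 (1 - ppow 2 (2 - s))).
  exact: (continuous_fcomp _ _ (continuous_sub_ppow 2 2 (ltr0Sn _ 1))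
                               (continuous_sub_ppow 1 1 ltr01)).
have c2 : continuous (fun s : R => ppow 1 (2 - s)).
  exact: continuous_sub_ppow.
exact: (continuous_mul _ _ (continuous_mul _ _ k2 c1) (continuous_mul _ _ k2 c2)).
Qed.

End weights.

Section radial.
Context {R : realType} {n : nat}.
Implicit Types (x : 'rV[R]_n) (e a b : R).

Lemma has_grad_ext (f g : 'rV[R]_n -> R) df dg : has_grad f df ->
  (forall x, f x = g x) -> (forall i x, df i x = dg i x) -> has_grad g dg.
Proof.
move=> h fg dfg; rewrite -(_ : f = g); last exact/funext.
by rewrite -(_ : df = dg)//; apply/funext => i; exact/funext.
Qed.

Definition sqn x : R := \sum_(i < n) x ord0 i ^+ 2.

Lemma sqn_ge0 x : 0 <= sqn x.
Proof. by apply: sumr_ge0 => i _; exact: sqr_ge0. Qed.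

Lemma eucl_norm_powR x a : eucl_norm x `^ a = sqn x `^ (a / 2).
Proof. by rewrite /eucl_norm -powR12_sqrt ?sqn_ge0// -powRrM mulrC. Qed.

Lemma norm_le_sqn x : `|x| <= Num.sqrt (sqn x).
Proof.
apply/ler_rV_norm => [|i]; first exact: sqrtr_ge0.
rewrite -sqrtr_sqr ler_wsqrtr// /sqn (bigD1 i)//= lerDl.
by apply: sumr_ge0 => j _; exact: sqr_ge0.
Qed.

Lemma has_grad_sqn : has_grad sqn (fun i x => 2 * x ord0 i).
Proof.
apply: (has_grad_ext _ _ _ _ (has_grad_sum _ (index_enum 'I_n)
  (fun j x => x ord0 j * x ord0 j) _
  (fun j => has_gradM _ _ _ _ (has_grad_coord j) (has_grad_coord j)))).
  by move=> x; apply: eq_bigr => i _; rewrite expr2.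
move=> i x; rewrite (bigD1 i)//= eqxx mul1r mulr1 big1 ?addr0.
  by rewrite mulr2n mulrDl !mul1r.
by move=> j ji; rewrite eq_sym (negbTE ji) mulr0 mul0r addr0.
Qed.

(** The regularized |x|^a. Its base is positive everywhere, so that products of weights add
    exponents even at the origin and for negative exponents. *)
Definition wgt e a x : R := hreg e (sqn x) `^ (a / 2).

Definition dwgt e a (i : 'I_n) x : R :=
  (a / 2) * hreg e (sqn x) `^ (a / 2 - 1) * (dhreg e (sqn x) * (2 * x ord0 i)).

Lemma has_grad_wgt e a : 0 < e -> has_grad (wgt e a) (dwgt e a).
Proof.
move=> e0.
have Hh := has_grad_comp _ _ _ _ has_grad_sqn
  (fun x => continuous_dhreg e (sqn x)) (fun x => is_derive_hreg e (sqn x)).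
apply: (has_grad_comp _ _ (fun t => t `^ (a / 2))
  (fun t => (a / 2) * t `^ (a / 2 - 1)) Hh) => x; last first.
  by apply: is_derive1_powR; exact: hreg_gt0.
have cp : {for hreg e (sqn x), continuous (fun t : R => t `^ (a / 2 - 1))}.
  apply/differentiable_continuous/derivable1_diffP.
  by apply: derivable_powR; rewrite in_itv/= andbT hreg_gt0.
exact: cvgM (cvg_cst (a / 2)) cp.
Qed.

Lemma wgt_gt0 e a x : 0 < e -> 0 < wgt e a x.
Proof. by move=> e0; rewrite powR_gt0// hreg_gt0. Qed.

Lemma wgtD e a b x : 0 < e -> wgt e (a + b) x = wgt e a x * wgt e b x.
Proof.
by move=> e0; rewrite /wgt mulrDl powRD// (gt_eqF (hreg_gt0 _ _ e0)) implybT.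
Qed.

Lemma wgt0 e x : wgt e 0 x = 1. Proof. by rewrite /wgt mul0r powRr0. Qed.

Lemma wgt2 e x : 0 < e -> wgt e 2 x = hreg e (sqn x).
Proof. by move=> e0; rewrite /wgt divff// powRr1// ltW// hreg_gt0. Qed.

Lemma wgtM e a b x : wgt e (a * b) x = wgt e a x `^ b.
Proof. by rewrite /wgt -powRrM mulrAC. Qed.

Lemma wgtE e a x : e <= sqn x -> wgt e a x = eucl_norm x `^ a.
Proof. by move=> ex; rewrite /wgt hregE// eucl_norm_powR. Qed.

Lemma dwgtE e a i x : 0 < e -> e <= sqn x ->
  dwgt e a i x = a * wgt e (a - 2) x * x ord0 i.
Proof.
move=> e0 ex; rewrite /dwgt dhregE// /wgt hregE// mul1r mulrBl divff//.
by field.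
Qed.

Definition cutoff e x : R := theta (sqn x / e).
Definition dcutoff e (i : 'I_n) x : R := dtheta (sqn x / e) * (2 * x ord0 i * e^-1).

Lemma has_grad_cutoff e : has_grad (cutoff e) (dcutoff e).
Proof.
have H1 := has_gradM _ _ _ _ has_grad_sqn (has_grad_cst (n := n) e^-1).
apply: (has_grad_ext _ _ _ _ (has_grad_comp _ _ _ _ H1
  (fun x => continuous_dtheta (sqn x / e)) (fun x => is_derive_theta (sqn x / e)))) => //.
by move=> i x; rewrite mulr0 addr0.
Qed.

Lemma cutoff_ge0 e x : 0 <= cutoff e x. Proof. exact: theta_ge0. Qed.
Lemma cutoff_le1 e x : cutoff e x <= 1. Proof. exact: theta_le1. Qed.

Lemma cutoff_eq0 e x : 0 < e -> sqn x <= e -> cutoff e x = 0.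
Proof. by move=> e0 xe; rewrite /cutoff theta0// ler_pdivrMr// mul1r. Qed.

Lemma cutoff_eq1 e x : 0 < e -> 2 * e <= sqn x -> cutoff e x = 1.
Proof. by move=> e0 xe; rewrite /cutoff theta1// ler_pdivlMr. Qed.

Lemma le_cutoff e e' x : 0 < e' -> e' <= e -> cutoff e x <= cutoff e' x.
Proof.
move=> e0 ee; apply: le_theta; rewrite ler_wpM2l ?sqn_ge0// lef_pV2 ?posrE//.
exact: lt_le_trans ee.
Qed.

Lemma dcutoff_eq0 e i x : 0 < e -> sqn x <= e \/ 2 * e <= sqn x -> dcutoff e i x = 0.
Proof.
move=> e0 xe; rewrite /dcutoff dtheta0 ?mul0r//.
by case: xe => xe; [left; rewrite ler_pdivrMr// mul1r|right; rewrite ler_pdivlMr].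
Qed.

(** 128 = 16 times 8: the square of [dtheta] is at most 16, and 4 |x|^2 / e^2 is at most 8 / e where
    |x|^2 <= 2 e. *)
Lemma sum_dcutoff_sqr e x : 0 < e -> \sum_i dcutoff e i x ^+ 2 <= 128 / e.
Proof.
move=> e0; have [xe|xe] := leP (2 * e) (sqn x).
  rewrite big1 ?divr_ge0 ?(ltW e0)// => i _.
  by rewrite dcutoff_eq0 ?expr0n//; right.
have -> : \sum_i dcutoff e i x ^+ 2 = dtheta (sqn x / e) ^+ 2 * (4 * sqn x / e ^+ 2).
  rewrite /dcutoff; move: (dtheta _) => d.
  rewrite /sqn mulr_sumr mulr_suml mulr_sumr; apply: eq_bigr => i _.
  by field; exact: lt0r_neq0.
have d1 : dtheta (sqn x / e) ^+ 2 <= 16.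
  have := dtheta_le4 (sqn x / e); have := dtheta_ge0 (sqn x / e); nra.
have d2 : 4 * sqn x / e ^+ 2 <= 8 / e.
  rewrite ler_pdivrMr ?exprn_gt0// expr2 mulrA divfK ?gt_eqF//; lra.
apply: (@le_trans _ _ (16 * (8 / e))).
  by rewrite ler_pM ?sqr_ge0// divr_ge0 ?sqr_ge0// mulr_ge0 ?sqn_ge0.
by rewrite mulrA -natrM.
Qed.

End radial.

Section has_grad_power.
Context {R : realType} {n : nat}.
Variables (f : 'rV[R]_n -> R) (df : 'I_n -> 'rV[R]_n -> R) (a : R).
Hypotheses (fdf : has_grad f df) (a1 : 1 < a).

Let a10 : 0 < a - 1. Proof. by rewrite subr_gt0. Qed.

Lemma has_grad_npow : has_grad (fun x => npow a (f x))
  (fun i x => a * spow (a - 1) (f x) * df i x).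
Proof.
apply: (has_grad_comp _ _ (npow a) (fun s => a * spow (a - 1) s) fdf) => x.
  exact: cvgM (cvg_cst a) (continuous_spow _ a10 (f x)).
exact: is_derive_npow.
Qed.

Lemma has_grad_spow : has_grad (fun x => spow a (f x))
  (fun i x => a * npow (a - 1) (f x) * df i x).
Proof.
apply: (has_grad_comp _ _ (spow a) (fun s => a * npow (a - 1) s) fdf) => x.
  exact: cvgM (cvg_cst a) (continuous_npow _ a10 (f x)).
exact: is_derive_spow.
Qed.

End has_grad_power.

(** * Real-valued integral calculus on [Cc] *)

Section compact_support_closure.
Context {R : realType} {n : nat}.
Implicit Types f g k : 'rV[R]_n -> R.

Lemma Cc_add f g : Cc f -> Cc g -> Cc (fun x => f x + g x).
Proof.
move=> [cf [M fM]] [cg [M' gM]]; split; first exact: continuous_add.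
exists (Num.max M M') => x; rewrite gt_max => /andP[Mx Mx'].
by rewrite fM// gM// addr0.
Qed.

Lemma Cc_mull k f : continuous k -> Cc f -> Cc (fun x => k x * f x).
Proof.
move=> ck [cf [M fM]]; split; first exact: continuous_mul.
by exists M => x Mx; rewrite fM// mulr0.
Qed.

Lemma Cc_scale (c : R) f : Cc f -> Cc (fun x => c * f x).
Proof. by apply: Cc_mull; exact: cst_continuous. Qed.

Lemma Cc_mulr k f : continuous k -> Cc f -> Cc (fun x => f x * k x).
Proof.
move=> ck [cf [M fM]]; split; first exact: continuous_mul.
by exists M => x Mx; rewrite fM// mul0r.
Qed.

Lemma Cc_comp (h : R -> R) f : continuous h -> h 0 = 0 -> Cc f ->
  Cc (fun x => h (f x)).
Proof.
move=> ch h0 [cf [M fM]]; split; first exact: continuous_fcomp.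
by exists M => x Mx; rewrite fM.
Qed.

Lemma Cc_sum (I : Type) (s : seq I) (F : I -> 'rV[R]_n -> R) :
  (forall i, Cc (F i)) -> Cc (fun x => \sum_(i <- s) F i x).
Proof.
move=> cF; elim: s => [|i s ih].
  under eq_fun do rewrite big_nil; split; first exact: cst_continuous.
  by exists 0.
by under eq_fun do rewrite big_cons; exact: Cc_add.
Qed.

Lemma Cc_eq f g : Cc f -> (forall x, f x = g x) -> Cc g.
Proof. by move=> cf fg; rewrite -(_ : f = g)//; exact/funext. Qed.

Lemma Cc_powR f a : 0 < a -> (forall x, 0 <= f x) -> Cc f ->
  Cc (fun x => f x `^ a).
Proof.
move=> a0 f0 cf; apply: (@Cc_eq (fun x => ppow a (f x))).
  apply: (Cc_comp (ppow a)) cf; first exact: continuous_ppow.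
  by rewrite ppow_neg// gt_eqF.
by move=> x; rewrite ppow_pos.
Qed.

(** [fine] sends infinite values to 0, so this is the true integral only when that is finite, as it
    is for [Cc] integrands. *)
Definition intg f : R := fine (\int[lebesgue_rV n]_x (f x)%:E).

Lemma EFin_intg f : Cc f -> (\int[lebesgue_rV n]_x (f x)%:E)%E = (intg f)%:E.
Proof.
move=> cf; rewrite /intg fineK//.
by apply: integrable_fin_num => //; exact: Cc_integrable.
Qed.

Lemma eq_intg f g : (forall x, f x = g x) -> intg f = intg g.
Proof. by move=> fg; rewrite (_ : f = g)//; exact/funext. Qed.

Lemma intg_ge0 f : (forall x, 0 <= f x) -> 0 <= intg f.
Proof.
by move=> f0; apply: fine_ge0; apply: integral_ge0 => x _; rewrite lee_fin.
Qed.

Lemma intgD f g : Cc f -> Cc g -> intg (fun x => f x + g x) = intg f + intg g.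
Proof.
move=> cf cg; apply: EFin_inj; rewrite EFinD -!EFin_intg//; last exact: Cc_add.
under eq_integral do rewrite EFinD.
by rewrite integralD//; exact: Cc_integrable.
Qed.

Lemma intgZ (c : R) f : Cc f -> intg (fun x => c * f x) = c * intg f.
Proof.
move=> cf; apply: EFin_inj; rewrite EFinM -!EFin_intg//; last first.
  by apply: Cc_mull => //; exact: cst_continuous.
under eq_integral do rewrite EFinM.
by rewrite integralZl//; exact: Cc_integrable.
Qed.

Lemma le_intg f g : Cc f -> Cc g -> (forall x, f x <= g x) -> intg f <= intg g.
Proof.
move=> cf cg fg; rewrite -lee_fin -!EFin_intg//.
by apply: le_integral => //; [exact: Cc_integrable|exact: Cc_integrable|
  move=> x _; rewrite lee_fin].
Qed.

Lemma intg_sum_eq0 (I : Type) (s : seq I) (F : I -> 'rV[R]_n -> R) :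
  (forall i, Cc (F i)) -> (forall i, intg (F i) = 0) ->
  intg (fun x => \sum_(i <- s) F i x) = 0.
Proof.
move=> cF F0; elim: s => [|i s ih].
  rewrite (eq_intg _ (fun x => 0 * 0)) => [|x]; last by rewrite big_nil mulr0.
  rewrite intgZ ?mul0r//; split; first exact: cst_continuous.
  by exists 0.
rewrite (eq_intg _ (fun x => F i x + \sum_(j <- s) F j x)) => [|x]; last first.
  by rewrite big_cons.
by rewrite intgD ?F0 ?ih ?addr0//; exact: Cc_sum.
Qed.

(** The divergence theorem without boundary term; the integrations by parts for Hardy's inequality
    and for the test function are instances. [dV i j] is the derivative of the i-th component in
    direction j. *)
Lemma intg_div_eq0 (V : 'I_n -> 'rV[R]_n -> R) dV M :
  (forall i, has_grad (V i) (dV i)) -> (forall i, vanish_outside M (V i)) ->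
  Cc (fun x => \sum_i dV i i x) /\ intg (fun x => \sum_i dV i i x) = 0.
Proof.
move=> VdV VM.
have cV i : Cc (dV i i).
  split; first exact: has_grad_dcontinuous (VdV i).
  by exists M; exact: has_grad_vanish (VdV i) (VM i).
split; first exact: Cc_sum.
apply: intg_sum_eq0 => // i.
by rewrite /intg (integral_grad_eq0 _ _ _ _ i (VdV i) (VM i)).
Qed.

Lemma intg_hoelder f g a b : Cc f -> Cc g ->
  (forall x, 0 <= f x) -> (forall x, 0 <= g x) ->
  0 < a -> 0 < b -> a + b = 1 ->
  intg (fun x => f x `^ a * g x `^ b) <= intg f `^ a * intg g `^ b.
Proof.
move=> cf cg f0 g0 a0 b0 ab.
rewrite -lee_fin -EFin_intg; last first.
  by apply: Cc_mull; [case: (Cc_powR f a a0 f0 cf)|exact: Cc_powR].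
rewrite EFinM -!poweR_EFin -!EFin_intg//.
under eq_integral do rewrite EFinM -!poweR_EFin.
apply: hoelder_weighted => //; apply/measurable_EFinP; exact: Cc_measurable.
Qed.

Lemma intg_cauchy_schwarz f g h : Cc f -> Cc g -> Cc h ->
  (forall x, 0 <= f x) -> (forall x, 0 <= g x) ->
  (forall x, h x ^+ 2 <= f x * g x) -> `|intg h| <= Num.sqrt (intg f * intg g).
Proof.
move=> cf cg ch f0 g0 hfg.
have half0 : 0 < 2^-1 :> R by [].
have c1 : Cc (fun x => f x `^ 2^-1 * g x `^ 2^-1).
  apply: Cc_mull; last exact: Cc_powR.
  by case: (Cc_powR f 2^-1 half0 f0 cf).
have hle x : `|h x| <= f x `^ 2^-1 * g x `^ 2^-1.
  rewrite -powRM// powR12_sqrt ?mulr_ge0// -sqrtr_sqr ler_wsqrtr//.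
apply: (@le_trans _ _ (intg (fun x => f x `^ 2^-1 * g x `^ 2^-1))); last first.
  rewrite -powR12_sqrt ?mulr_ge0 ?intg_ge0// powRM ?intg_ge0//.
  by apply: intg_hoelder => //; lra.
rewrite ler_norml; apply/andP; split; last first.
  by apply: le_intg => // x; exact: le_trans (ler_norm _) (hle x).
rewrite -mulN1r -intgZ//; apply: le_intg => //.
  by apply: Cc_mull => //; exact: cst_continuous.
by move=> x; rewrite mulN1r lerNl; apply: le_trans (hle x); rewrite -normrN ler_norm.
Qed.

End compact_support_closure.

(** Absorption: a real Y > 0 can be divided by Y^r, which closes an estimate of Y by a smaller power
    of itself. *)
Lemma powR_self_bound {R : realType} (Y A r : R) : 0 <= Y -> 0 <= A -> r < 1 ->
  Y <= A * Y `^ r -> Y <= A `^ (1 - r)^-1.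
Proof.
move=> Y0 A0 r1 YA; have r10 : 0 < 1 - r by rewrite subr_gt0.
have [->|Yn0] := eqVneq Y 0; first exact: powR_ge0.
have Yp : 0 < Y by rewrite lt0r Yn0.
have : Y `^ (1 - r) <= A.
  rewrite powRB ?powRr1 ?Yn0 ?implybT// ler_pdivrMr// powR_gt0//.
move=> YrA; rewrite [leLHS](_ : Y = (Y `^ (1 - r)) `^ (1 - r)^-1); last first.
  by rewrite -powRrM mulfV ?powRr1// lt0r_neq0.
by apply: ge0_ler_powR; rewrite ?nnegrE ?powR_ge0// invr_ge0 ltW.
Qed.

(** * Sobolev's inequality in dimension N = n+2 *)

Section sobolev.
Context {R : realType} (n : nat).
Hypothesis n0 : (0 < n)%N.
Local Notation nu := (n%:R : R).

Let nu0 : 0 < nu. Proof. by rewrite ltr0n. Qed.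

Let t : R := 2 * (nu + 1) / nu.
Let c : R := 1 + n.+1%:R^-1.

Let n1E : n.+1%:R = nu + 1 :> R. Proof. by rewrite -natr1. Qed.

(** The Gagliardo inequality is applied to |phi|^t with t = 2(N-1)/(N-2). This t is chosen so that t
    N/(N-1) is the Sobolev exponent and t - 1 is half of it: Cauchy-Schwarz then returns the square
    root of the left-hand integral, and its power [c / 2] < 1 is absorbed. *)
Lemma sobolev (phi : 'rV[R]_n.+2 -> R) dphi M :
  has_grad phi dphi -> vanish_outside M phi ->
  intg (fun x => npow (2 * (nu + 2) / nu) (phi x)) <=
  (t ^+ 2 * intg (fun x => \sum_i dphi i x ^+ 2)) `^ ((nu + 2) / nu).
Proof.
move=> phid phiM; have nu1 := nu0.
have t1 : 1 < t by rewrite /t ltr_pdivlMr//; lra.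
have t0 : 0 < t by exact: lt_trans t1.
have t10 : 0 < t - 1 by rewrite subr_gt0.
set pstar := 2 * (nu + 2) / nu.
have p0 : 0 < pstar by rewrite /pstar divr_gt0// mulr_gt0// addr_gt0.
have Cphi : Cc phi by split; [exact: has_grad_continuous phid|exists M].
have CD : Cc (fun x => \sum_i dphi i x ^+ 2).
  apply: Cc_sum => i; apply: (Cc_comp (fun s => s ^+ 2)); rewrite ?expr0n//.
    exact: exprn_continuous.
  split; first exact: has_grad_dcontinuous phid.
  by exists M; exact: has_grad_vanish phid phiM.
have D0 x : 0 <= \sum_i dphi i x ^+ 2 by apply: sumr_ge0 => i _; exact: sqr_ge0.
have CY : Cc (fun x => npow pstar (phi x)).
  apply: (Cc_comp (npow pstar)) => //; first exact: continuous_npow.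
  by rewrite npow0// gt_eqF.
have fd := has_grad_npow _ _ _ phid t1.
have fM : vanish_outside M (fun x => npow t (phi x)).
  by move=> x Mx; rewrite phiM// npow0// gt_eqF.
pose g x := npow (t - 1) (phi x) * Num.sqrt (\sum_i dphi i x ^+ 2).
have Cg : Cc g.
  apply: Cc_mulr.
    apply: (continuous_fcomp _ Num.sqrt); first by case: CD.
    exact: sqrt_continuous.
  apply: (Cc_comp (npow (t - 1))) => //; first exact: continuous_npow.
  by rewrite npow0// gt_eqF.
have g0 x : 0 <= g x by rewrite mulr_ge0 ?npow_ge0 ?sqrtr_ge0.
have CG : Cc (fun x => t * g x) by apply: Cc_mull => //; exact: cst_continuous.
have dG i x : `|t * spow (t - 1) (phi x) * dphi i x| <= t * g x.
  rewrite normrM [X in X * _]normrM (gtr0_norm t0) norm_spow ?gt_eqF// -mulrA.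
  rewrite (ler_wpM2l (ltW t0))// ler_wpM2l ?npow_ge0// -sqrtr_sqr.
  rewrite ler_wsqrtr// (bigD1 i)//= lerDl.
  by apply: sumr_ge0 => j _; exact: sqr_ge0.
have LB := has_grad_line_bounded _ _ _ _ _ fd fM (Cc_continuous _ CG) dG.
have mf : measurable_fun setT (fun x => `|npow t (phi x)|%:E).
  apply/measurable_EFinP; apply: measurableT_comp => //.
  by apply: continuous_measurable_rV; case: fd.
have mG : measurable_fun setT (fun x => (t * g x)%:E).
  by apply/measurable_EFinP; exact: Cc_measurable.
have nf0 x : (0 <= `|npow t (phi x)|%:E)%E by rewrite lee_fin.
have nG0 x : (0 <= (t * g x)%:E)%E by rewrite lee_fin mulr_ge0// (ltW t0).
have := gagliardo_nirenberg _ _ _ mf mG nf0 nG0 LB.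
have -> : (\int[lebesgue_rV n.+2]_x (`|npow t (phi x)|%:E `^ (1 + n.+1%:R^-1)) =
    \int[lebesgue_rV n.+2]_x (npow pstar (phi x))%:E)%E.
  apply: eq_integral => x _.
  rewrite poweR_EFin ger0_norm ?npow_ge0// /npow -powRrM.
  congr (_ `^ _)%:E.
  by rewrite /t /pstar n1E; field; rewrite !gt_eqF// addr_gt0.
rewrite (EFin_intg _ CY) (EFin_intg _ CG) poweR_EFin lee_fin -/c.
rewrite intgZ//.
set Y := intg _; set D := intg (fun x => \sum_i _) => YG.
have Y0 : 0 <= Y by apply: intg_ge0 => x; exact: npow_ge0.
have D_0 : 0 <= D by exact: intg_ge0.
have gYD : intg g <= Y `^ 2^-1 * D `^ 2^-1.
  rewrite (eq_intg g (fun x => npow pstar (phi x) `^ 2^-1 *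
     (\sum_i dphi i x ^+ 2) `^ 2^-1)) => [|x]; last first.
    rewrite [X in _ = _ * X]powR12_sqrt// /npow -powRrM /g; congr (_ * _).
    by rewrite /npow /pstar /t; congr (_ `^ _); field; rewrite gt_eqF.
  apply: intg_hoelder => //; last by lra.
  by move=> x; exact: npow_ge0.
have c0 : 0 < c by rewrite /c addr_gt0// invr_gt0.
have ctwo : c / 2 < 1.
  have : (nu + 1)^-1 < 1 by rewrite invf_lt1 ?addr_gt0// ltrDr.
  by rewrite ltr_pdivrMr// mul1r /c n1E; lra.
have Y1 : Y <= (t ^+ 2 * D) `^ (c / 2) * Y `^ (c / 2).
  apply: (le_trans YG); rewrite -powRM ?mulr_ge0 ?sqr_ge0//.
  rewrite -mulrA [D * Y]mulrC.
  rewrite (_ : c / 2 = 2^-1 * c); last by rewrite mulrC.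
  rewrite powRrM; apply: ge0_ler_powR; rewrite ?nnegrE ?powR_ge0 ?(ltW c0)//.
    by rewrite mulr_ge0 ?(ltW t0)// intg_ge0.
  rewrite powRM ?sqr_ge0 ?mulr_ge0// powR12_sqrt ?sqr_ge0// sqrtr_sqr.
  by rewrite gtr0_norm// powRM// (ler_wpM2l (ltW t0)).
have := powR_self_bound _ _ _ Y0 (powR_ge0 _ _) ctwo Y1.
rewrite -powRrM (_ : c / 2 / (1 - c / 2) = (nu + 2) / nu)//.
rewrite /c n1E; field.
by rewrite !gt_eqF ?addr_gt0//; lra.
Qed.

End sobolev.

(** The weights are tuned for a main term k X with cross term 2 z: half of k X survives, both in
    Hardy's inequality and in the estimate with the test function. *)
Lemma amgm_bound {R : realType} (X Y z k : R) : 0 <= X -> 0 <= Y -> 0 < k ->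
  z ^+ 2 <= X * Y -> - (k / 2 * X + 2 / k * Y) <= 2 * z.
Proof.
move=> X0 Y0 k0 zXY; rewrite lerNl.
set S := _ + _; have S0 : 0 <= S.
  by rewrite addr_ge0 ?mulr_ge0// ?invr_ge0// ltW.
have zS : `|2 * z| <= `|S|.
  rewrite -ler_sqr ?nnegrE// !real_normK ?num_real//.
  apply: (@le_trans _ _ (4 * (X * Y))).
    by rewrite exprMn (_ : 2 ^+ 2 = 4 :> R) ?ler_pM2l// -natrX.
  have -> : S ^+ 2 = (k / 2 * X - 2 / k * Y) ^+ 2 + 4 * (X * Y).
    by rewrite /S; field; rewrite gt_eqF.
  by rewrite lerDr sqr_ge0.
by rewrite -(ger0_norm S0); apply: le_trans zS; rewrite -normrN ler_norm.
Qed.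

(** * The weighted Hardy inequality *)

Section hardy.
Context {R : realType} {n : nat}.
Variables (e a M : R) (w : 'rV[R]_n -> R) (dw : 'I_n -> 'rV[R]_n -> R).
Hypotheses (e0 : 0 < e) (wdw : has_grad w dw) (wM : vanish_outside M w).
Hypothesis we : forall x, sqn x <= e -> w x = 0.

Lemma Cc_weighted (k : 'rV[R]_n -> R) b : Cc k -> Cc (fun x => wgt e b x * k x).
Proof. by apply: Cc_mull; case: (has_grad_wgt (n := n) e b e0). Qed.

Let Cw : Cc w. Proof. by split; [case: wdw|exists M]. Qed.

Let Cdw i : Cc (dw i).
Proof.
split; first exact: has_grad_dcontinuous wdw.
by exists M; exact: has_grad_vanish wdw wM.
Qed.

Definition energy : R := intg (fun x => wgt e a x * \sum_i dw i x ^+ 2).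

Let Csq (k : 'rV[R]_n -> R) : Cc k -> Cc (fun x => k x ^+ 2).
Proof.
by apply: (Cc_comp (fun s => s ^+ 2)); rewrite ?expr0n//; exact: exprn_continuous.
Qed.

Lemma Cc_energy : Cc (fun x => wgt e a x * \sum_i dw i x ^+ 2).
Proof. by apply: Cc_weighted; apply: Cc_sum => i; exact: Csq. Qed.

Lemma Cc_hardy b : Cc (fun x => wgt e b x * w x ^+ 2).
Proof. by apply: Cc_weighted; exact: Csq. Qed.

Let c := n%:R + a - 2.

(** Euler's identity for the homogeneous function |x|^b. *)
Let sum_wgt (x : 'rV[R]_n) b : e <= sqn x ->
  \sum_i dwgt e b i x * x ord0 i = b * wgt e b x.
Proof.
move=> ex; transitivity (b * wgt e (b - 2) x * sqn x).
  rewrite mulr_sumr; apply: eq_bigr => i _.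
  by rewrite dwgtE// -mulrA -expr2.
by rewrite -{1}(hregE e (sqn x) ex) -(wgt2 e x e0) -mulrA -wgtD// subrK.
Qed.

(** The field |x|^(a-2) w^2 x has integral of divergence 0. Its divergence is c |x|^(a-2) w^2 plus a
    cross term in w x . grad w, which [amgm_bound] splits. On the ball where the regularized weight
    differs from |x|^a, w vanishes, and only the sign of the energy term matters. *)
Lemma hardy : 0 < c ->
  intg (fun x => wgt e (a - 2) x * w x ^+ 2) <= 4 / c ^+ 2 * energy.
Proof.
move=> c0.
have VdV i := has_gradM _ _ _ _ (has_gradM _ _ _ _ (has_grad_wgt e (a - 2) e0)
  (has_grad_coord i)) (has_gradM _ _ _ _ wdw wdw).
set dV := fun i j x => (dwgt e (a - 2) j x * x ord0 i +
  wgt e (a - 2) x * (j == i)%:R) * (w x * w x) +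
  wgt e (a - 2) x * x ord0 i * (dw j x * w x + w x * dw j x).
have VM i : vanish_outside M (fun x => wgt e (a - 2) x * x ord0 i * (w x * w x)).
  by move=> x Mx; rewrite wM// !mulr0.
have [CdV dV0] := intg_div_eq0 _ dV M VdV VM.
have le_dV x : c / 2 * (wgt e (a - 2) x * w x ^+ 2) +
    - (2 / c) * (wgt e a x * \sum_i dw i x ^+ 2) <= \sum_i dV i i x.
  have wa0 := ltW (wgt_gt0 (n := n) e (a - 2) x e0).
  have [xe|ex] := leP (sqn x) e.
    rewrite we// expr0n/= !mulr0 add0r.
    rewrite [leRHS]big1 => [|i _]; last by rewrite /dV we// !(mulr0, mul0r, addr0).
    rewrite mulNr oppr_le0 mulr_ge0 ?divr_ge0 ?(ltW c0)//.
    rewrite mulr_ge0 ?(ltW (wgt_gt0 _ _ _ _))// sumr_ge0// => i _.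
    exact: sqr_ge0.
  have h0 : 0 < sqn x by exact: lt_trans ex.
  have -> : \sum_i dV i i x = c * (wgt e (a - 2) x * w x ^+ 2) +
      wgt e (a - 2) x * \sum_i 2 * (w x * x ord0 i * dw i x).
    rewrite /dV big_split/=; congr (_ + _); last first.
      by rewrite mulr_sumr; apply: eq_bigr => i _; ring.
    rewrite -mulr_suml big_split/= sum_wgt ?(ltW ex)// -mulr_sumr.
    rewrite (_ : \sum_(i < n) (i == i)%:R = n%:R) ?/c; first by ring.
    by under eq_bigr do rewrite eqxx; rewrite sumr_const card_ord.
  have -> : wgt e a x = wgt e (a - 2) x * sqn x.
    by rewrite -{1}(hregE e (sqn x) (ltW ex)) -(wgt2 e x e0) -wgtD// subrK.
  have key : - (c / 2 * w x ^+ 2 + 2 / c * (sqn x * \sum_i dw i x ^+ 2)) <=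
      \sum_i 2 * (w x * x ord0 i * dw i x).
    have -> : c / 2 * w x ^+ 2 + 2 / c * (sqn x * \sum_i dw i x ^+ 2) =
        \sum_i (c / 2 * (w x ^+ 2 * x ord0 i ^+ 2 / sqn x) +
                2 / c * (sqn x * dw i x ^+ 2)).
      rewrite big_split/= -!mulr_sumr -mulr_suml -mulr_sumr -/(sqn x).
      by rewrite mulfK// gt_eqF.
    rewrite -sumrN; apply: ler_sum => i _.
    apply: amgm_bound => //.
    - by apply: divr_ge0; [rewrite mulr_ge0 ?sqr_ge0|exact: ltW].
    - by apply: mulr_ge0; [exact: ltW|exact: sqr_ge0].
    - have -> : w x ^+ 2 * x ord0 i ^+ 2 / sqn x * (sqn x * dw i x ^+ 2) =
          (w x * x ord0 i * dw i x) ^+ 2 by field; rewrite gt_eqF.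
      exact: lexx.
  have := ler_wpM2l wa0 key.
  move: (wgt e (a - 2) x) (\sum_i dw i x ^+ 2) (\sum_i 2 * _) => W Sd St.
  move=> H; apply: le_trans (lerD (lexx (c * (W * w x ^+ 2))) H).
  by rewrite le_eqVlt; apply/orP; left; apply/eqP; field; rewrite gt_eqF.
have CH := Cc_hardy (a - 2); have CE := Cc_energy.
have C1 := Cc_scale (c / 2) _ CH.
have C2 := Cc_scale (- (2 / c)) _ CE.
have := le_intg _ _ (Cc_add _ _ C1 C2) CdV le_dV.
rewrite dV0 (intgD _ _ C1 C2).
rewrite !intgZ// -/energy; set H := intg _ => Hle.
have -> : 4 / c ^+ 2 * energy = (2 / c) * ((2 / c) * energy).
  by field; rewrite gt_eqF.
rewrite -ler_pdivrMl ?divr_gt0// invf_div; lra.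
Qed.

(* The left-hand side is the Dirichlet energy of |x|^(a/2) w: this conjugation
   reduces the weighted problem to the unweighted Sobolev inequality. *)
Lemma energy_conjugate : 0 < c ->
  intg (fun x => \sum_i (dwgt e (a / 2) i x * w x + wgt e (a / 2) x * dw i x) ^+ 2)
  <= (2 * a ^+ 2 / c ^+ 2 + 2) * energy.
Proof.
move=> c0.
have CD : Cc (fun x =>
    \sum_i (dwgt e (a / 2) i x * w x + wgt e (a / 2) x * dw i x) ^+ 2).
  apply: Cc_sum => i; apply: Csq.
  have [ct /(_ i)[cd _]] := has_grad_wgt (n := n) e (a / 2) e0.
  by apply: Cc_add; apply: Cc_mull.
have CH := Cc_hardy (a - 2); have CE := Cc_energy.
apply: (@le_trans _ _ (a ^+ 2 / 2 * intg (fun x => wgt e (a - 2) x * w x ^+ 2) +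
    2 * energy)); last first.
  rewrite [leRHS]mulrDl lerD2r.
  rewrite [leRHS](_ : _ = a ^+ 2 / 2 * (4 / c ^+ 2 * energy)); last first.
    by field; rewrite gt_eqF.
  by rewrite ler_wpM2l ?hardy// divr_ge0 ?sqr_ge0.
have C1 := Cc_scale (a ^+ 2 / 2) _ CH.
have C2 := Cc_scale (2 : R) _ CE.
rewrite /energy -!intgZ// -intgD//.
apply: le_intg => //; first exact: Cc_add.
move=> x.
have -> : wgt e a x = wgt e (a / 2) x ^+ 2.
  by rewrite expr2 -wgtD//; congr (wgt e _ x); field.
(* The squared gradient of |x|^(a/2) is a^2/4 |x|^(a-2); the claim reduces to (X + Y Z)^2 <= 2 X^2 +
   2 (Y Z)^2. *)
have -> : a ^+ 2 / 2 * (wgt e (a - 2) x * w x ^+ 2) =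
    \sum_i 2 * (dwgt e (a / 2) i x * w x) ^+ 2.
  have [xe|ex] := leP (sqn x) e.
    by rewrite we// expr0n/= !mulr0 big1// => i _; rewrite mulr0 expr0n/= mulr0.
  transitivity (a ^+ 2 / 2 * w x ^+ 2 * wgt e (a / 2 - 2) x ^+ 2 * sqn x).
    rewrite -{1}(hregE e (sqn x) (ltW ex)) -(wgt2 e x e0) -(mulrA _ _ (wgt e 2 x)).
    rewrite [wgt _ _ _ ^+ 2]expr2 -!wgtD//.
    rewrite (_ : a / 2 - 2 + (a / 2 - 2) + 2 = a - 2); last by field.
    by ring.
  rewrite mulr_sumr; apply: eq_bigr => i _.
  by rewrite dwgtE ?(ltW ex)//; field.
rewrite mulrA mulr_sumr -big_split/=; apply: ler_sum => i _.
move: (dwgt e (a / 2) i x * w x) (wgt e (a / 2) x) (dw i x) => X Y Z.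
rewrite -subr_ge0.
rewrite (_ : _ - _ = (X - Y * Z) ^+ 2); last by ring.
exact: sqr_ge0.
Qed.

End hardy.

(** * The first-order Caffarelli-Kohn-Nirenberg inequality *)

Section caffarelli_kohn_nirenberg.
Context {R : realType} (n : nat).
Variables (a b : R).
Local Notation N := (n.+2%:R : R).
Local Notation nu := (n%:R : R).
Hypotheses (n0 : (0 < n)%N) (ha : 2 - N < a) (hb1 : a - 2 < b)
  (hb2 : b <= N / (N - 2) * a).

Let s : R := 2 * (N + b) / (N + a - 2).

(** [th] solves s = 2 (1 - th) + th 2N/(N-2), and the weight exponents then match: (a-2)(1-th) + th
    a N/(N-2) = b. The condition a - 2 < b is th > 0, and b <= a N/(N-2) is th <= 1. *)
Lemma caffarelli_kohn_nirenberg : exists2 C : R, 0 < C &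
  forall (e M : R) (w : 'rV[R]_n.+2 -> R) dw, 0 < e -> has_grad w dw ->
    vanish_outside M w -> (forall x, sqn x <= e -> w x = 0) ->
    intg (fun x => wgt e b x * npow s (w x)) <= C * energy e a dw `^ (s / 2).
Proof.
have nu0 : 0 < nu by rewrite ltr0n.
have NE : N = nu + 2 by rewrite -addn2 natrD.
have b1 := hb1; have a1 := ha; rewrite NE in a1.
set c := N + a - 2; have c0 : 0 < c by rewrite /c NE; lra.
set th := (s - 2) * nu / 4.
set sg := 2 * (nu + 2) / nu.
set t := 2 * (nu + 1) / nu.
have sE : s - 2 = 2 * (b - a + 2) / c.
  rewrite /s -/c (_ : N + b = c + (b - a + 2)); last by rewrite /c; ring.
  by move: c c0 => d d0; field; rewrite gt_eqF.
have th0 : 0 < th.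
  have : 0 < b - a + 2 by lra.
  by move=> ba; rewrite /th sE divr_gt0// mulr_gt0// divr_gt0// mulr_gt0.
have hb : b * nu <= (nu + 2) * a.
  move: hb2; rewrite NE -[nu + 2 - 2]addrA subrr addr0.
  by rewrite mulrAC ler_pdivlMr.
have th1 : th <= 1.
  have -> : th = (b - a + 2) * nu / (2 * c).
    by rewrite /th sE; field; rewrite gt_eqF.
  rewrite ler_pdivrMr ?mulr_gt0// /c NE; lra.
have s0 : s != 0.
  have : 0 < s - 2 by rewrite sE divr_gt0//; lra.
  by move=> ?; rewrite gt_eqF//; lra.
have sg0 : 0 < sg by rewrite /sg divr_gt0// mulr_gt0// addr_gt0.
set K := 2 * a ^+ 2 / c ^+ 2 + 2.
have K0 : 0 < K by rewrite /K ltr_wpDl// divr_ge0 ?sqr_ge0// mulr_ge0 ?sqr_ge0.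
set r := (nu + 2) / nu.
have r0 : 0 < r by rewrite /r divr_gt0// addr_gt0.
have t0 : 0 < t by rewrite /t divr_gt0// mulr_gt0// addr_gt0.
have t20 : 0 < t ^+ 2 * K by rewrite mulr_gt0// exprn_gt0.
have c20 : 0 < 4 / c ^+ 2 by rewrite divr_gt0// exprn_gt0.
exists ((4 / c ^+ 2) `^ (1 - th) * (t ^+ 2 * K) `^ (r * th)).
  by rewrite mulr_gt0// powR_gt0.
move=> e M w dw e0 wdw wM we.
set G := energy e a dw.
have G0 : 0 <= G.
  apply: intg_ge0 => x; rewrite mulr_ge0 ?(ltW (wgt_gt0 _ _ _ e0))//.
  by apply: sumr_ge0 => i _; exact: sqr_ge0.
pose phi x := wgt e (a / 2) x * w x.
have phid := has_gradM _ _ _ _ (has_grad_wgt e (a / 2) e0) wdw.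
have phiM : vanish_outside M phi by move=> x Mx; rewrite /phi wM ?mulr0.
have Cphi : Cc phi by split; [case: phid|exists M].
have Cw : Cc w by split; [case: wdw|exists M].
pose E1 x := npow sg (phi x); pose H1 x := wgt e (a - 2) x * w x ^+ 2.
have E10 x : 0 <= E1 x by exact: npow_ge0.
have H10 x : 0 <= H1 x.
  by rewrite mulr_ge0 ?sqr_ge0// ltW// wgt_gt0.
have CE : Cc E1.
  apply: (Cc_comp (npow sg)) => //; first exact: continuous_npow.
  by rewrite npow0// gt_eqF.
have CH : Cc H1 := Cc_hardy _ _ _ _ e0 wdw wM (a - 2).
have Hle : intg H1 <= 4 / c ^+ 2 * G := hardy _ _ _ _ _ e0 wdw wM we c0.
have Ele : intg E1 <= (t ^+ 2 * K * G) `^ r.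
  apply: le_trans (sobolev n n0 phi _ M phid phiM) _.
  apply: (ge0_ler_powR (ltW r0)).
  - rewrite nnegrE mulr_ge0 ?sqr_ge0// intg_ge0// => x.
    by apply: sumr_ge0 => i _; exact: sqr_ge0.
  - by rewrite nnegrE mulr_ge0// ltW.
  - rewrite -[leRHS]mulrA; apply: ler_wpM2l; first exact: sqr_ge0.
    exact: energy_conjugate e0 wdw wM we c0.
have fE x : wgt e b x * npow s (w x) = H1 x `^ (1 - th) * E1 x `^ th.
  have w0 : 0 <= wgt e (a - 2) x by rewrite ltW// wgt_gt0.
  have w1 : 0 <= wgt e (a / 2) x by rewrite ltW// wgt_gt0.
  rewrite /H1 /E1 -npow2 powRM ?npow_ge0// -wgtM /npow -!powRrM.
  rewrite /phi normrM (ger0_norm w1) powRM// -wgtM mulrACA -wgtD//.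
  rewrite -powRD; last first.
    rewrite (_ : 2 * (1 - th) + sg * th = s) ?(negbTE s0)//.
    by rewrite /sg /th; field; rewrite gt_eqF.
  congr (wgt e _ x * _ `^ _).
    by rewrite /sg /th sE /c NE; field; rewrite !gt_eqF// -?NE.
  by rewrite /sg /th; field; rewrite gt_eqF.
have interp : intg (fun x => wgt e b x * npow s (w x)) <=
    intg H1 `^ (1 - th) * intg E1 `^ th.
  rewrite (eq_intg _ _ fE).
  (* The endpoint th = 1 is Sobolev's inequality alone and is separated because Hölder asks for
     positive exponents. *)
  move: th1; rewrite le_eqVlt => /predU1P[->|th1].
    rewrite subrr powRr0 mul1r powRr1 ?intg_ge0//.
    by rewrite (eq_intg _ E1)// => x; rewrite powRr0 mul1r powRr1.
  by apply: intg_hoelder => //; [rewrite subr_gt0|rewrite subrK].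
apply: le_trans interp _.
have th10 : 0 <= 1 - th by rewrite subr_ge0.
apply: (@le_trans _ _ ((4 / c ^+ 2 * G) `^ (1 - th) *
    ((t ^+ 2 * K * G) `^ r) `^ th)).
  apply: ler_pM; rewrite ?powR_ge0//.
    by apply: (ge0_ler_powR th10); rewrite ?nnegrE ?intg_ge0// mulr_ge0// ltW.
  by apply: (ge0_ler_powR (ltW th0)); rewrite ?nnegrE ?intg_ge0// powR_ge0.
rewrite -powRrM (@powRM _ (4 / c ^+ 2) G)// ?(ltW c20)//.
rewrite (@powRM _ (t ^+ 2 * K) G)// ?(ltW t20)// mulrACA.
have ex : 1 - th + r * th = s / 2.
  by rewrite /r /th; field; rewrite gt_eqF.
have s20 : s / 2 != 0 by rewrite mulf_eq0 negb_or s0 invr_eq0 pnatr_eq0.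
by rewrite -powRD ex// (negbTE s20).
Qed.

End caffarelli_kohn_nirenberg.

(** * Testing against |u|^(k-1) u with a cutoff *)

Section truncated_estimate.
Context {R : realType} {n : nat}.
Variables (e a b k M : R) (u : 'rV[R]_n -> R).
Variables (du : 'I_n -> 'rV[R]_n -> R) (ddu : 'I_n -> 'I_n -> 'rV[R]_n -> R).
Hypotheses (e0 : 0 < e) (k1 : 1 < k).
Hypotheses (udu : has_grad u du) (duddu : forall i, has_grad (du i) (ddu i)).
Hypothesis uM : vanish_outside M u.

(* The power 3 ensures cutoff^10 <= zeta^s for s <= 10/3, that is for N >= 5. *)
Definition zeta (x : 'rV[R]_n) : R := cutoff e x ^+ 3.
Definition dzeta i (x : 'rV[R]_n) : R := 3 * cutoff e x ^+ 2 * dcutoff e i x.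

Lemma has_grad_zeta : has_grad zeta dzeta.
Proof.
have H := has_grad_cutoff (n := n) e.
apply: (has_grad_ext _ _ _ _ (has_gradM _ _ _ _ H (has_gradM _ _ _ _ H H))).
  by move=> x; rewrite /zeta; ring.
by move=> i x; rewrite /dzeta; ring.
Qed.

Definition trunc x : R := npow ((k + 1) / 2) (u x) * zeta x.
Definition dtrunc i x : R :=
  (k + 1) / 2 * spow ((k + 1) / 2 - 1) (u x) * du i x * zeta x +
  npow ((k + 1) / 2) (u x) * dzeta i x.

Let k0 : 0 < k. Proof. exact: lt_trans k1. Qed.
Let k10 : 0 < k - 1. Proof. by rewrite subr_gt0. Qed.
Let kp0 : 0 < k + 1. Proof. by rewrite addr_gt0. Qed.
Let kh1 : 1 < (k + 1) / 2.
Proof. by rewrite ltr_pdivlMr// mul1r -[2]/(1 + 1) ltrD2r. Qed.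
Let kh0 : 0 < (k + 1) / 2. Proof. exact: lt_trans kh1. Qed.

Lemma has_grad_trunc : has_grad trunc dtrunc.
Proof. exact: has_gradM (has_grad_npow _ _ _ udu kh1) has_grad_zeta. Qed.

Lemma trunc_vanish : vanish_outside M trunc.
Proof. by move=> x Mx; rewrite /trunc uM// npow0 ?mul0r// gt_eqF. Qed.

Lemma trunc_near0 x : sqn x <= e -> trunc x = 0.
Proof. by move=> xe; rewrite /trunc /zeta cutoff_eq0// expr0n mulr0. Qed.

Definition wdiv x : R :=
  \sum_i (dwgt e a i x * du i x + wgt e a x * ddu i i x).

(** [X] is the part of the energy density to be controlled, [Y] the part created by differentiating
    the cutoff; the cross term of the integration by parts is bounded by their geometric mean. *)
Let X i x := npow (k - 1) (u x) * du i x ^+ 2 * zeta x ^+ 2.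
Let Y i x := npow (k + 1) (u x) * dzeta i x ^+ 2.

Definition cutoff_error : R := intg (fun x => wgt e a x * \sum_i Y i x).

Let cu : continuous u. Proof. by case: udu. Qed.
Let cdu i : continuous (du i). Proof. exact: has_grad_dcontinuous udu. Qed.
Let cz : continuous zeta. Proof. by case: has_grad_zeta. Qed.
Let cdz i : continuous (dzeta i).
Proof. exact: has_grad_dcontinuous has_grad_zeta. Qed.
Let cwgt c : continuous (wgt (n := n) e c).
Proof. by case: (has_grad_wgt (n := n) e c e0). Qed.
Let cdwgt c i : continuous (dwgt (n := n) e c i).
Proof. exact: has_grad_dcontinuous (has_grad_wgt e c e0). Qed.
Let csqr (f : 'rV[R]_n -> R) : continuous f -> continuous (fun x => f x ^+ 2).
Proof.
move=> cf; apply: (continuous_fcomp _ (fun s => s ^+ 2)) => //.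
exact: exprn_continuous.
Qed.

Let Cu : Cc u. Proof. by split=> //; exists M. Qed.
Let Cnpow c : 0 < c -> Cc (fun x => npow c (u x)).
Proof.
move=> c0; apply: (Cc_comp (npow c)) => //; first exact: continuous_npow.
by rewrite npow0// gt_eqF.
Qed.

Let CX : Cc (fun x => wgt e a x * \sum_i X i x).
Proof.
apply: Cc_mull => //; apply: Cc_sum => i.
by apply: Cc_mulr; [exact: csqr|apply: Cc_mulr; [exact: csqr|exact: Cnpow]].
Qed.

Lemma Cc_cutoff_error : Cc (fun x => wgt e a x * \sum_i Y i x).
Proof.
apply: Cc_mull => //; apply: Cc_sum => i.
by apply: Cc_mulr; [exact: csqr|exact: Cnpow].
Qed.

Lemma continuous_wdiv : continuous wdiv.
Proof.
apply: continuous_sum => i; apply: continuous_add; apply: continuous_mul => //.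
exact: has_grad_dcontinuous (duddu i).
Qed.

Let Cspow : Cc (fun x => spow k (u x)).
Proof.
apply: (Cc_comp (spow k)) => //; first exact: continuous_spow.
by rewrite /spow oppr0 subrr.
Qed.

Let test x := wdiv x * (spow k (u x) * zeta x ^+ 2).

Let Ctest : Cc test.
Proof.
apply: Cc_mull; first exact: continuous_wdiv.
by apply: Cc_mulr => //; exact: csqr.
Qed.

Let wa0 x : 0 <= wgt (n := n) e a x. Proof. by rewrite ltW// wgt_gt0. Qed.

Let J := intg (fun x => wgt e a x * \sum_i X i x).

(* Testing div(|x|^a grad u) against |u|^(k-1) u zeta^2. *)
Lemma test_bound : k / 2 * J <= `|intg test| + 2 / k * cutoff_error.
Proof.
have FdF i := has_gradM _ _ _ _ (has_gradM _ _ _ _ (has_grad_wgt e a e0) (duddu i))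
  (has_gradM _ _ _ _ (has_grad_spow _ _ _ udu k1)
    (has_gradM _ _ _ _ has_grad_zeta has_grad_zeta)).
set dF := fun i j x => (dwgt e a j x * du i x + wgt e a x * ddu i j x) *
    (spow k (u x) * (zeta x * zeta x)) + wgt e a x * du i x *
    (k * npow (k - 1) (u x) * du j x * (zeta x * zeta x) +
     spow k (u x) * (dzeta j x * zeta x + zeta x * dzeta j x)).
have FM i : vanish_outside M (fun x => wgt e a x * du i x *
    (spow k (u x) * (zeta x * zeta x))).
  by move=> x Mx; rewrite uM// /spow oppr0 subrr mul0r mulr0.
have [CdF dF0] := intg_div_eq0 _ dF M FdF FM.
have le_dF x : test x + (k / 2 * (wgt e a x * \sum_i X i x) +
    - (2 / k) * (wgt e a x * \sum_i Y i x)) <= \sum_i dF i i x.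
  have -> : \sum_i dF i i x = test x + wgt e a x * \sum_i
      (k * X i x + 2 * (du i x * spow k (u x) * zeta x * dzeta i x)).
    rewrite /test /wdiv mulr_suml mulr_sumr -big_split/=.
    by apply: eq_bigr => i _; rewrite /dF /X; ring.
  rewrite lerD2l.
  rewrite (_ : _ + _ = wgt e a x *
      (\sum_i (k / 2 * X i x - 2 / k * Y i x))); last first.
    by rewrite sumrB -!mulr_sumr; ring.
  apply: ler_wpM2l => //; apply: ler_sum => i _.
  have X0 : 0 <= X i x.
    by apply: mulr_ge0; [apply: mulr_ge0; [exact: npow_ge0|]|]; exact: sqr_ge0.
  have Y0 : 0 <= Y i x by apply: mulr_ge0; [exact: npow_ge0|exact: sqr_ge0].
  (* Equality holds, because |u|^(2k) = |u|^(k-1) |u|^(k+1). *)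
  have z2 : (du i x * spow k (u x) * zeta x * dzeta i x) ^+ 2 <= X i x * Y i x.
    have kk : spow k (u x) ^+ 2 = npow (k - 1) (u x) * npow (k + 1) (u x).
      rewrite spow_sqr ?gt_eqF// -npowD.
        by congr (npow _ _); ring.
      by rewrite gt_eqF// addr_gt0.
    rewrite /X /Y le_eqVlt; apply/orP; left; apply/eqP.
    transitivity (du i x ^+ 2 * spow k (u x) ^+ 2 * zeta x ^+ 2 * dzeta i x ^+ 2).
      by ring.
    by rewrite kk; ring.
  have := lerD (lexx (k * X i x)) (amgm_bound _ _ _ _ X0 Y0 k0 z2).
  apply: le_trans; rewrite le_eqVlt; apply/orP; left; apply/eqP.
  by field; rewrite gt_eqF.
have C1 := Cc_scale (k / 2) _ CX.
have C2 := Cc_scale (- (2 / k)) _ Cc_cutoff_error.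
have := le_intg _ _ (Cc_add _ _ Ctest (Cc_add _ _ C1 C2)) CdF le_dF.
rewrite dF0 (intgD _ _ Ctest (Cc_add _ _ C1 C2)) (intgD _ _ C1 C2).
rewrite (intgZ _ _ CX) (intgZ _ _ Cc_cutoff_error) -/J -/cutoff_error.
have := ler_norm (- intg test); rewrite normrN.
move: (intg test) `|intg test| (k / 2 * J) (2 / k) cutoff_error => T T' j K E.
by lra.
Qed.

Let CdTr : Cc (fun x => wgt e a x * \sum_i dtrunc i x ^+ 2).
Proof.
exact: (Cc_energy _ a _ _ _ e0 has_grad_trunc trunc_vanish).
Qed.

Lemma energy_trunc : energy e a dtrunc <=
  (k + 1) ^+ 2 / 2 * J + 2 * cutoff_error.
Proof.
have C1 := Cc_scale ((k + 1) ^+ 2 / 2) _ CX.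
have C2 := Cc_scale 2 _ Cc_cutoff_error.
rewrite /J /cutoff_error -(intgZ _ _ CX) -(intgZ _ _ Cc_cutoff_error).
rewrite -(intgD _ _ C1 C2).
apply: le_intg => //; first exact: Cc_add.
move=> x.
rewrite (_ : _ + _ = wgt e a x *
    (\sum_i ((k + 1) ^+ 2 / 2 * X i x + 2 * Y i x))); last first.
  by rewrite big_split/= -!mulr_sumr; ring.
apply: ler_wpM2l => //; apply: ler_sum => i _.
set A := (k + 1) / 2 * spow ((k + 1) / 2 - 1) (u x) * du i x * zeta x.
set B := npow ((k + 1) / 2) (u x) * dzeta i x.
have -> : (k + 1) ^+ 2 / 2 * X i x = 2 * A ^+ 2.
  have kh10 : (k + 1) / 2 - 1 != 0 by rewrite subr_eq0 gt_eqF.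
  have kk : spow ((k + 1) / 2 - 1) (u x) ^+ 2 = npow (k - 1) (u x).
    by rewrite spow_sqr//; congr (npow _ _); field.
  by rewrite /X -kk /A; field.
have -> : Y i x = B ^+ 2.
  rewrite /B exprMn [npow _ _ ^+ 2]expr2 -npowD; last by rewrite gt_eqF// addr_gt0.
  by rewrite -mulrDl -mulr2n -[(k + 1) *+ 2]mulr_natr mulfK.
rewrite /dtrunc -/A -/B -subr_ge0 (_ : _ - _ = (A - B) ^+ 2); last by ring.
exact: sqr_ge0.
Qed.

Let p := 2 * k.
Let s := 4 * k / (k + 1).

Lemma npow_trunc x : npow s (trunc x) = npow p (u x) * cutoff e x `^ (3 * s).
Proof.
rewrite /trunc /npow normrM powRM// (ger0_norm (powR_ge0 _ _)) -powRrM.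
rewrite (_ : (k + 1) / 2 * s = p); last first.
  by rewrite /s /p; field; rewrite gt_eqF.
rewrite /zeta ger0_norm ?exprn_ge0 ?cutoff_ge0//.
by rewrite -(powR_mulrn 3 (cutoff_ge0 e x)) -[in LHS]powRrM.
Qed.

Hypothesis s10 : 3 * s <= 10.

Definition wdiv_energy : R :=
  intg (fun x => wgt e (- b) x * (wdiv x ^+ 2 * cutoff e x ^+ 2)).

Let Cwdiv : Cc wdiv.
Proof.
split; first exact: continuous_wdiv.
exists M => x Mx; rewrite /wdiv big1// => i _.
have duM := has_grad_vanish _ _ _ i udu uM.
by rewrite duM// (has_grad_vanish _ _ _ i (duddu i) duM)// !mulr0 addr0.
Qed.

Let ccut : continuous (cutoff (n := n) e).
Proof. by case: (has_grad_cutoff (n := n) e). Qed.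

Lemma Cc_wdiv_energy :
  Cc (fun x => wgt e (- b) x * (wdiv x ^+ 2 * cutoff e x ^+ 2)).
Proof.
apply: Cc_mull => //; apply: Cc_mulr; first exact: csqr.
apply: (Cc_comp (fun s => s ^+ 2)); rewrite ?expr0n//.
exact: exprn_continuous.
Qed.

Lemma Cc_npow_trunc : Cc (fun x => wgt e b x * npow s (trunc x)).
Proof.
have s0 : 0 < s by rewrite /s divr_gt0// mulr_gt0.
apply: Cc_mull => //; apply: (Cc_comp (npow s)).
- exact: continuous_npow.
- by rewrite npow0// gt_eqF.
- by split; [case: has_grad_trunc|exists M; exact: trunc_vanish].
Qed.

(** The square of the test integrand contains [cutoff] to the power 12. Two factors stay with the
    divergence and hide the ball where the weight is not |x|^a; the other ten are at most cutoff^(3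
    s) = zeta^s, since 3 s <= 10 and the cutoff is at most 1. *)
Lemma test_cauchy_schwarz : `|intg test| <=
  Num.sqrt (wdiv_energy * intg (fun x => wgt e b x * npow s (trunc x))).
Proof.
have p0 : 0 < p by rewrite mulr_gt0.
have wc0 c x : 0 <= wgt (n := n) e c x by rewrite ltW// wgt_gt0.
have Cg : Cc (fun x => wgt e b x * (npow p (u x) * cutoff e x ^+ 10)).
  apply: Cc_mull => //; apply: Cc_mulr; last exact: Cnpow.
  by apply: (continuous_fcomp _ (fun s => s ^+ 10)) => //; exact: exprn_continuous.
have CA := Cc_wdiv_energy; have CX' := Cc_npow_trunc.
apply: (@le_trans _ _ (Num.sqrt (wdiv_energy *
    intg (fun x => wgt e b x * (npow p (u x) * cutoff e x ^+ 10))))).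
  apply: intg_cauchy_schwarz => //.
  - by move=> x; apply: mulr_ge0 => //; apply: mulr_ge0; exact: sqr_ge0.
  - move=> x; apply: mulr_ge0 => //; apply: mulr_ge0; first exact: npow_ge0.
    by rewrite exprn_ge0// cutoff_ge0.
  move=> x; rewrite le_eqVlt; apply/orP; left; apply/eqP.
  have kk : spow k (u x) ^+ 2 = npow p (u x).
    by rewrite spow_sqr ?gt_eqF//; congr (npow _ _); rewrite /p; ring.
  have ww : wgt e (- b) x * wgt e b x = 1 by rewrite -wgtD// addNr wgt0.
  transitivity (wgt e (- b) x * wgt e b x *
      (wdiv x ^+ 2 * (npow p (u x) * (zeta x ^+ 2) ^+ 2))).
    by rewrite ww -kk /test; ring.
  by rewrite /zeta; ring.
apply: ler_wsqrtr; apply: ler_wpM2l.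
  by apply: intg_ge0 => x; apply: mulr_ge0 => //; apply: mulr_ge0; exact: sqr_ge0.
apply: le_intg => // x; apply: ler_wpM2l => //.
rewrite npow_trunc; apply: ler_wpM2l; first exact: npow_ge0.
have [->|c0] := eqVneq (cutoff e x) 0; first by rewrite expr0n/= powR_ge0.
rewrite -(powR_mulrn 10 (cutoff_ge0 e x)); apply: ger_powR => //.
by rewrite lt0r c0 cutoff_ge0 cutoff_le1.
Qed.

Lemma energy_trunc_bound : energy e a dtrunc <= (k + 1) ^+ 2 / k *
  Num.sqrt (wdiv_energy * intg (fun x => wgt e b x * npow s (trunc x))) +
  (2 * (k + 1) ^+ 2 / k ^+ 2 + 2) * cutoff_error.
Proof.
apply: (le_trans energy_trunc).
have := le_trans test_bound (lerD test_cauchy_schwarz (lexx _)).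
set S := Num.sqrt _ => H.
have : (k + 1) ^+ 2 / k * (k / 2 * J) <=
    (k + 1) ^+ 2 / k * (S + 2 / k * cutoff_error).
  by apply: ler_wpM2l => //; rewrite divr_ge0 ?sqr_ge0// ltW.
rewrite (_ : (k + 1) ^+ 2 / k * (k / 2 * J) = (k + 1) ^+ 2 / 2 * J); last first.
  by field; rewrite gt_eqF.
rewrite [leRHS]mulrDr.
rewrite (_ : (k + 1) ^+ 2 / k * (2 / k * cutoff_error) =
  2 * (k + 1) ^+ 2 / k ^+ 2 * cutoff_error); last by field; rewrite gt_eqF.
by move=> H1; rewrite [in leRHS]mulrDl addrA lerD2r.
Qed.

(** The integrand lives on e <= |x|^2 <= 2 e, inside a cube of side 2 (2 e)^(1/2). There |grad
    zeta|^2 <= 9 times 128 / e = 1152 / e and the weight is of order e^(a/2), so the orders multiply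
    to e^(a/2 - 1 + n/2). *)
Lemma cutoff_error_bound (B : R) : (forall x, `|u x| <= B) ->
  cutoff_error <=
  B `^ (k + 1) * (1152 * (1 + 2 `^ (a / 2)) * (2 * Num.sqrt 2) ^+ n) *
  e `^ ((a - 2 + n%:R) / 2).
Proof.
move=> uB; have B0 : 0 <= B by apply: le_trans (uB 0).
have e20 : 0 < 2 * e by rewrite mulr_gt0.
pose r := Num.sqrt (2 * e).
have r0 : 0 <= r by exact: sqrtr_ge0.
pose W := B `^ (k + 1) * (1152 / e) * ((1 + 2 `^ (a / 2)) * e `^ (a / 2)).
have W0 : 0 <= W.
  apply: mulr_ge0; apply: mulr_ge0.
  - exact: powR_ge0.
  - by apply: divr_ge0; [exact: ler0n|exact: ltW].
  - by apply: addr_ge0; [exact: ler01|exact: powR_ge0].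
  - exact: powR_ge0.
have CE := Cc_cutoff_error.
have bound : cutoff_error <= W * (2 * r) ^+ n.
  rewrite -lee_fin -EFin_intg//; apply: le_integral_cube => //.
  - exact: Cc_measurable.
  - move=> x; apply: mulr_ge0 => //; apply: sumr_ge0 => i _.
    by apply: mulr_ge0; [exact: npow_ge0|exact: sqr_ge0].
  - move=> x; have [xe|ex] := leP (sqn x) e.
      rewrite big1 ?mulr0// => i _.
      by rewrite /Y /dzeta dcutoff_eq0 ?mulr0 ?expr0n ?mulr0//; left.
    have [xe|xe] := leP (2 * e) (sqn x).
      rewrite big1 ?mulr0// => i _.
      by rewrite /Y /dzeta dcutoff_eq0 ?mulr0 ?expr0n ?mulr0//; right.
    have YB : \sum_i Y i x <= B `^ (k + 1) * (1152 / e).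
      rewrite /Y -mulr_sumr; apply: ler_pM; rewrite ?npow_ge0//.
      + by apply: sumr_ge0 => i _; exact: sqr_ge0.
      + by apply: ge0_ler_powR; rewrite ?nnegrE// ltW.
      apply: (@le_trans _ _ (9 * \sum_i dcutoff e i x ^+ 2)).
        rewrite mulr_sumr; apply: ler_sum => i _.
        have -> : dzeta i x ^+ 2 = 9 * (cutoff e x ^+ 4 * dcutoff e i x ^+ 2).
          by rewrite /dzeta; ring.
        apply: ler_wpM2l => //; apply: ler_piMl; first exact: sqr_ge0.
        by rewrite exprn_ile1 ?cutoff_ge0 ?cutoff_le1.
      rewrite (_ : 1152 / e = 9 * (128 / e)); last by field; rewrite gt_eqF.
      by apply: ler_wpM2l => //; exact: sum_dcutoff_sqr.
    (* With y = |x|^2 / e in [1, 2], y^(a/2) is at most 2^(a/2) or 1 according to the sign of a; the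
       sum covers both cases. *)
    have wB : wgt e a x <= (1 + 2 `^ (a / 2)) * e `^ (a / 2).
      rewrite /wgt hregE ?(ltW ex)//.
      pose y := sqn x / e.
      have y1 : 1 <= y by rewrite ler_pdivlMr// mul1r; exact: ltW.
      have y2 : y <= 2 by rewrite ler_pdivrMr//; exact: ltW.
      have y0 : 0 <= y by exact: le_trans y1.
      rewrite (_ : sqn x = y * e); last by rewrite divfK// gt_eqF.
      rewrite (powRM _ y0 (ltW e0)).
      apply: ler_wpM2r; first exact: powR_ge0.
      have [a0|a0] := leP 0 (a / 2).
        apply: (@le_trans _ _ (2 `^ (a / 2))); last by rewrite lerDr.
        by apply: ge0_ler_powR; rewrite ?nnegrE.
      apply: (@le_trans _ _ 1); last by rewrite lerDl powR_ge0.
      by rewrite -[leRHS](powRr0 y); apply: ler_powR => //; exact: ltW.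
    rewrite mulrC /W; apply: ler_pM => //.
    by apply: sumr_ge0 => i _; rewrite /Y mulr_ge0 ?npow_ge0 ?sqr_ge0.
  - move=> x rx; rewrite big1 ?mulr0// => i _.
    have xe : 2 * e <= sqn x.
      rewrite leNgt; apply/negP => xe.
      have := le_lt_trans (ler_wsqrtr (ltW xe)) (lt_le_trans rx (norm_le_sqn x)).
      by rewrite ltxx.
    by rewrite /Y /dzeta dcutoff_eq0 ?mulr0 ?expr0n ?mulr0//; right.
apply: (le_trans bound); rewrite le_eqVlt; apply/orP; left; apply/eqP.
rewrite /r sqrtrM// mulrA exprMn /W.
have -> : Num.sqrt e ^+ n = e `^ (n%:R / 2).
  by rewrite -powR12_sqrt ?ltW// -powR_mulrn ?powR_ge0// -powRrM mulrC.
rewrite (_ : (a - 2 + n%:R) / 2 = a / 2 + n%:R / 2 - 1); last by field.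
rewrite powRB; last by apply/implyP => _; rewrite gt_eqF.
rewrite (powRr1 (ltW e0)) (@powRD _ e); last by apply/implyP => _; rewrite gt_eqF.
by field; rewrite gt_eqF.
Qed.

End truncated_estimate.

(** At a fixed j the error may exceed X_j^(1/2). The bound is therefore used at a later index i: X_i
    >= X_j > 0 stays away from 0, while eps_i is as small as desired compared with X_j^(1/2). *)
Lemma powR_le_of_perturbed_bounds {R : realType} (X eps : nat -> R) (P Q p : R) :
  0 < p -> 0 <= P -> 0 <= Q -> (forall j, 0 <= X j) ->
  {homo X : i j / (i <= j)%N >-> i <= j} ->
  (forall eta, 0 < eta -> exists j0, forall j, (j0 <= j)%N -> eps j <= eta) ->
  (forall j, X j `^ (2^-1 + p^-1) <= P * X j `^ 2^-1 + Q * eps j) ->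
  forall j, X j <= P `^ p.
Proof.
move=> p0 P0 Q0 X0 Xnd eps0 Xle j.
have [->|Xj] := eqVneq (X j) 0; first exact: powR_ge0.
have {}Xj : 0 < X j by rewrite lt0r Xj X0.
suff XP : X j `^ p^-1 <= P.
  rewrite -(powRr1 (X0 j)) -[X in _ `^ X](mulVf (lt0r_neq0 p0)) powRrM.
  by apply: ge0_ler_powR; rewrite ?nnegrE ?powR_ge0//; exact: ltW.
have xj : 0 < X j `^ 2^-1 by exact: powR_gt0.
have Q1 : 0 < Q + 1 by rewrite ltr_wpDl.
apply/ler_addgt0Pr => eta eta0.
have [j0 j0P] := eps0 (eta * X j `^ 2^-1 / (Q + 1)) (divr_gt0 (mulr_gt0 eta0 xj) Q1).
pose i := maxn j0 j.
have Xji : X j <= X i by apply: Xnd; exact: leq_maxr.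
have Xi : 0 < X i by exact: lt_le_trans Xji.
have xi : 0 < X i `^ 2^-1 by exact: powR_gt0.
have rootle r : 0 <= r -> X j `^ r <= X i `^ r.
  by move=> r0; apply: ge0_ler_powR; rewrite ?nnegrE.
apply: (le_trans (rootle p^-1 _)); first by rewrite invr_ge0; exact: ltW.
have := Xle i; rewrite powRD; last by apply/implyP => _; rewrite gt_eqF.
move=> H; rewrite -(ler_pM2l xi); apply: (le_trans H).
rewrite mulrDr [X i `^ _ * P]mulrC lerD2l.
apply: (@le_trans _ _ (eta * X j `^ 2^-1)); last first.
  by rewrite [leRHS]mulrC; apply: ler_wpM2l; [exact: ltW|apply: rootle].
have : Q * eps i <= Q * (eta * X j `^ 2^-1 / (Q + 1)).
  by apply: ler_wpM2l => //; apply: j0P; exact: leq_maxl.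
move/le_trans; apply; rewrite mulrA ler_pdivrMr// mulrC.
by apply: ler_wpM2l; [apply: mulr_ge0; exact: ltW|rewrite lerDl].
Qed.

(** The integral of a nonnegative function is a supremum over the simple functions below it. This
    serves to compare with the integrand of the theorem, whose divergence is only computed away from
    the origin. *)
Lemma ge0_le_integral_nonmeasurable {d} {T : measurableType d} {R : realType}
    (mu : {measure set T -> \bar R}) (f g : T -> \bar R) :
  (forall x, (0 <= f x)%E) -> (forall x, (f x <= g x)%E) ->
  (\int[mu]_x f x <= \int[mu]_x g x)%E.
Proof.
move=> f0 fg; have g0 x : (0 <= g x)%E by exact: le_trans (fg x).
rewrite !ge0_integralTE//; apply: le_ereal_sup => _ /= [h hf <-].
by exists h => // x; exact: le_trans (hf x) (fg x).
Qed.

Lemma pow_inv_nat_small {R : realType} (K d : R) : 0 <= K -> 0 < d ->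
  forall eta, 0 < eta -> exists j0, forall j, (j0 <= j)%N ->
    K * (j.+1%:R^-1) `^ d <= eta.
Proof.
move=> K0 d0 eta eta0; have K1 : 0 < K + 1 by rewrite ltr_wpDl.
pose r := (eta / (K + 1)) `^ d^-1.
have r0 : 0 < r by rewrite powR_gt0// divr_gt0.
exists (Num.truncn r^-1) => j jr.
have jle : j.+1%:R^-1 <= r.
  rewrite invf_ple ?posrE//; apply: ltW.
  by apply: lt_le_trans (truncnS_gt _) _; rewrite ler_nat.
have : j.+1%:R^-1 `^ d <= eta / (K + 1).
  rewrite (_ : eta / (K + 1) = r `^ d); last first.
    by rewrite -powRrM mulVf ?gt_eqF// powRr1// divr_ge0// ltW.
  by apply: ge0_ler_powR; rewrite ?nnegrE//; exact: ltW.
move/(ler_wpM2l K0)/le_trans; apply.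
rewrite mulrA ler_pdivrMr// mulrC; apply: ler_wpM2l; first exact: ltW.
by rewrite lerDl.
Qed.

(** * From smoothness and compact support to explicit gradients *)

Section smooth_functions.
Context {R : realType} {n : nat}.
Variable u : 'rV[R]_n -> R.
Hypothesis su : smooth u.
Local Notation du := (fun i => partial i u).
Local Notation ddu := (fun i j => partial j (partial i u)).

Lemma smooth_has_grad : has_grad u du.
Proof.
split=> [|i]; first by have [] := su [::].
split=> [|x]; first by have [] := su [:: i].
by apply/derivableP; have [_] := su [::]; exact.
Qed.

Lemma smooth_has_grad2 i : has_grad (du i) (ddu i).
Proof.
split=> [|j]; first by have [] := su [:: i].
split=> [|x]; first by have [] := su [:: j; i].
by apply/derivableP; have [_] := su [:: i]; exact.
Qed.

(** The inequality e < |x|^2 is strict so that the regularized weight equals |y|^a on a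
    neighbourhood of x, which is what the derivatives see. *)
Lemma divergence_wdiv (e a : R) x : 0 < e -> e < sqn x ->
  divergence (fun y => eucl_norm y `^ a *: gradient u y) x =
  wdiv e a du ddu x.
Proof.
move=> e0 ex; apply: eq_bigr => i _.
have [_ /(_ i)[_ D]] := has_gradM _ _ _ _ (has_grad_wgt e a e0) (smooth_has_grad2 i).
have [_ <-] := D x; apply: near_eq_derive.
have : nbhs x [set y : 'rV[R]_n | e < sqn y].
  apply: open_nbhs_nbhs; split => //.
  apply: (@open_comp _ _ sqn [set r | e < r]); last exact: open_gt.
  by move=> y _; case: (has_grad_sqn (R := R) (n := n)) => + _; exact.
by apply: filterS => y ey; rewrite !mxE (wgtE e a y (ltW ey)).
Qed.

End smooth_functions.

Lemma compactly_supported_vanish {R : realType} {n} (u : 'rV[R]_n -> R) :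
  compactly_supported u -> exists M, vanish_outside M u.
Proof.
move=> /compact_bounded[M [_ MB]]; exists (`|M| + 1) => x Mx.
apply/eqP; apply: contraLR Mx => ux; rewrite -leNgt.
apply: (MB (`|M| + 1)); last exact: subset_closure.
by rewrite (le_lt_trans (ler_norm _))// ltrDl.
Qed.

(** * Arithmetic of the exponents and the truncated inequality *)

Section main_estimate.
Context {R : realType} (n : nat).
Variables (a b : R).
Local Notation N := (n.+2%:R : R).
Local Notation nu := (n%:R : R).
Hypotheses (n3 : (3 <= n)%N) (ha : 2 - N < a) (hb1 : a - 2 < b)
  (hb2 : b <= N / (N - 2) * a).

(* p is the exponent of the theorem; its test function |u|^(k-1) u and
   w = |u|^((k+1)/2) are tuned so that |w|^s = |u|^p. *)
Let k : R := (N + b) / (N - 4 + 2 * a - b).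
Let s : R := 4 * k / (k + 1).
Let p : R := 2 * k.

Let NE : N = nu + 2. Proof. by rewrite -addn2 natrD. Qed.
Let nu3 : 3 <= nu. Proof. by rewrite (ler_nat R 3). Qed.
Let a1 : 0 < nu + a. Proof. by have := ha; rewrite NE; lra. Qed.

Let hb : b * nu <= (nu + 2) * a.
Proof.
have nu0 : 0 < nu by apply: lt_le_trans nu3.
move: hb2; rewrite NE -[nu + 2 - 2]addrA subrr addr0.
by rewrite mulrAC ler_pdivlMr.
Qed.

(** Multiplied by N - 2, the expression is at least (N - 4)(N - 2 + a) by the upper bound on b; this
    is positive as N > 4. *)
Let den0 : 0 < N - 4 + 2 * a - b.
Proof.
have nu0 : 0 < nu by apply: lt_le_trans nu3.
rewrite -(pmulr_lgt0 _ nu0) NE.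
have : 0 < (nu - 2) * (nu + a).
  by rewrite mulr_gt0// subr_gt0; apply: lt_le_trans nu3; rewrite ltr_nat.
have := hb; nra.
Qed.

(** Clearing the positive denominator, this is a - 2 < b. *)
Lemma truncated_exponent_gt1 : 1 < k.
Proof. by rewrite /k ltr_pdivlMr// mul1r; have := hb1; lra. Qed.
Let k1 := truncated_exponent_gt1.

Let kp1 : k + 1 = 2 * (nu + a) / (N - 4 + 2 * a - b).
Proof. by rewrite /k NE; field; move: den0; rewrite NE => d; rewrite gt_eqF. Qed.

Let sE : s = 2 * (N + b) / (N + a - 2).
Proof.
have -> : N + a - 2 = nu + a by rewrite NE; ring.
rewrite /s kp1 /k; move: den0 a1; move: (N - 4 + 2 * a - b) (nu + a) => d c d0 c0.
by field; rewrite !gt_eqF.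
Qed.

(** The upper bound on b gives s <= 2N/(N-2), and this is at most 10/3 exactly for N >= 5. *)
Let s10 : 3 * s <= 10.
Proof.
rewrite sE (_ : N + a - 2 = nu + a); last by rewrite NE; ring.
rewrite mulrA ler_pdivrMr// NE.
have nu0 : 0 < nu by apply: lt_le_trans nu3.
rewrite -(ler_pM2r nu0).
have := hb; have : 0 <= (nu - 3) * (nu + a) by rewrite mulr_ge0 ?subr_ge0// ltW.
nra.
Qed.

(** The constants are chosen before u; the size of u enters only through [B] in the error term,
    which disappears as e tends to 0. The exponent on the left is 2/s. *)
Lemma truncated_sobolev : exists2 K : R * R, 0 < K.1 /\ 0 <= K.2 &
  forall (u : 'rV[R]_n.+2 -> R) du ddu M (B : R), has_grad u du ->
    (forall i, has_grad (du i) (ddu i)) -> vanish_outside M u ->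
    (forall x, `|u x| <= B) ->
  forall e, 0 < e ->
    intg (fun x => wgt e b x * npow s (trunc e k u x)) `^ (2^-1 + p^-1) <=
    K.1 * Num.sqrt (wdiv_energy e a b du ddu) *
    intg (fun x => wgt e b x * npow s (trunc e k u x)) `^ 2^-1 +
    K.2 * (B `^ (k + 1) * e `^ ((a + nu) / 2)).
Proof.
have n0 : (0 < n)%N by apply: leq_trans n3.
have [C C0 ckn] := caffarelli_kohn_nirenberg n a b n0 ha hb1 hb2.
rewrite -sE in ckn.
have k0 : 0 < k by exact: lt_trans k1.
have kp0 : 0 < k + 1 by rewrite addr_gt0.
have s0 : 0 < s by rewrite /s divr_gt0// mulr_gt0.
have sp : 2 / s = 2^-1 + p^-1 by rewrite /s /p; field; rewrite !gt_eqF.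
set L := C `^ (2 / s).
have L0 : 0 < L by exact: powR_gt0.
set c2 := (2 * (k + 1) ^+ 2 / k ^+ 2 + 2).
have c20 : 0 <= c2.
  by rewrite addr_ge0// divr_ge0 ?sqr_ge0// mulr_ge0 ?sqr_ge0.
set c3 := 1152 * (1 + 2 `^ (a / 2)) * (2 * Num.sqrt 2) ^+ n.+2.
have c30 : 0 <= c3.
  apply: mulr_ge0; first apply: mulr_ge0.
  - exact: ler0n.
  - by apply: addr_ge0; [exact: ler01|exact: powR_ge0].
  - by apply: exprn_ge0; apply: mulr_ge0; [exact: ler0n|exact: sqrtr_ge0].
exists (L * ((k + 1) ^+ 2 / k), L * (c2 * c3)) => /=.
  split; last by apply: mulr_ge0; [exact: ltW|exact: mulr_ge0].
  by rewrite mulr_gt0// divr_gt0// exprn_gt0.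
move=> u du ddu M B udu duddu uM uB e e0.
set X := intg (fun x => wgt e b x * npow s (trunc e k u x)).
have X0 : 0 <= X.
  apply: intg_ge0 => x; apply: mulr_ge0; last exact: npow_ge0.
  by rewrite ltW// wgt_gt0.
have A0 : 0 <= wdiv_energy e a b du ddu.
  apply: intg_ge0 => x; apply: mulr_ge0; first by rewrite ltW// wgt_gt0.
  by apply: mulr_ge0; exact: sqr_ge0.
have gle := ckn _ _ _ _ e0 (has_grad_trunc e k u du k1 udu)
  (trunc_vanish e k M u k1 uM) (trunc_near0 e k u e0).
have := energy_trunc_bound e a b k M u du ddu e0 k1 udu duddu uM s10.
rewrite -/X -/c2 => Ele.
have cerr := cutoff_error_bound e a k M u du e0 k1 udu uM B uB.
rewrite -/c3 (_ : a - 2 + n.+2%:R = a + nu) in cerr; last by rewrite NE; ring.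
set G := energy e a _ in gle Ele.
have G0 : 0 <= G.
  apply: intg_ge0 => x; apply: mulr_ge0; first by rewrite ltW// wgt_gt0.
  by apply: sumr_ge0 => i _; exact: sqr_ge0.
have XG : X `^ (2^-1 + p^-1) <= L * G.
  rewrite -sp.
  apply: (@le_trans _ _ ((C * G `^ (s / 2)) `^ (2 / s))).
    apply: ge0_ler_powR => //; rewrite ?nnegrE//.
      by rewrite divr_ge0// ltW.
    by apply: mulr_ge0; [exact: ltW|exact: powR_ge0].
  rewrite (powRM _ (ltW C0) (powR_ge0 _ _)) -powRrM.
  rewrite (_ : s / 2 * (2 / s) = 1); last by field; rewrite gt_eqF.
  by rewrite (powRr1 G0).
apply: (le_trans XG).
have : G <= (k + 1) ^+ 2 / k * (Num.sqrt (wdiv_energy e a b du ddu) * X `^ 2^-1) +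
    c2 * (c3 * (B `^ (k + 1) * e `^ ((a + nu) / 2))).
  apply: (le_trans Ele); rewrite sqrtrM// (powR12_sqrt X0); apply: lerD => //.
  apply: ler_wpM2l => //; apply: (le_trans cerr).
  by rewrite mulrA [c3 * _]mulrC.
move/(ler_wpM2l (ltW L0)); rewrite mulrDr !mulrA; exact.
Qed.

End main_estimate.

(** * Removing the cutoff by monotone convergence *)

Section limit.
Context {R : realType} {n : nat}.
Variables (b k : R) (u : 'rV[R]_n -> R).
Hypotheses (k1 : 1 < k) (cu : continuous u).
Local Notation s := (4 * k / (k + 1)).
Local Notation p := (2 * k).

Let s0 : 0 < s.
Proof.
have k0 : 0 < k by exact: lt_trans k1.
by rewrite divr_gt0// ?mulr_gt0// addr_gt0.
Qed.

(** Exhibits the cutoff as the only factor depending on e, which gives monotonicity in e; where the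
    regularized weight differs from |x|^b both sides are 0. *)
Lemma wgt_npow_trunc e x : 0 < e ->
  wgt e b x * npow s (trunc e k u x) =
  eucl_norm x `^ b * npow p (u x) * cutoff e x `^ (3 * s).
Proof.
move=> e0; have [xe|ex] := leP (sqn x) e; last first.
  by rewrite npow_trunc// (wgtE e b x (ltW ex)) mulrA.
rewrite trunc_near0// npow0 ?gt_eqF// cutoff_eq0// powR0 ?mulr0//.
by rewrite gt_eqF// mulr_gt0.
Qed.

Lemma continuous_eucl_norm : continuous (@eucl_norm R n).
Proof.
apply: (continuous_fcomp _ Num.sqrt); last exact: sqrt_continuous.
by case: (has_grad_sqn (R := R) (n := n)).
Qed.

Lemma measurable_weighted_power :
  measurable_fun setT (fun x => eucl_norm x `^ b * npow p (u x)).
Proof.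
apply: measurable_funM.
  apply: (measurableT_comp (measurable_powR b)).
  exact: continuous_measurable_rV continuous_eucl_norm.
apply: continuous_measurable_rV; apply: (continuous_fcomp _ (npow p)) => //.
by apply: continuous_npow; rewrite mulr_gt0//; exact: lt_trans k1.
Qed.

Let e (j : nat) : R := j.+1%:R^-1.
Let e0 j : 0 < e j. Proof. by rewrite invr_gt0. Qed.
Let fj j x : R := wgt (e j) b x * npow s (trunc (e j) k u x).

Lemma le_wgt_npow_trunc i j x : (i <= j)%N -> fj i x <= fj j x.
Proof.
move=> ij; rewrite /fj (wgt_npow_trunc _ _ (e0 i)) (wgt_npow_trunc _ _ (e0 j)).
apply: ler_wpM2l.
  by apply: mulr_ge0; [exact: powR_ge0|exact: npow_ge0].
apply: ge0_ler_powR.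
- by apply: mulr_ge0; [exact: ler0n|exact: ltW].
- by rewrite nnegrE; exact: cutoff_ge0.
- by rewrite nnegrE; exact: cutoff_ge0.
- apply: le_cutoff; first exact: e0.
  by rewrite lef_pV2 ?posrE ?ltr0n// ler_nat ltnS.
Qed.

(** The origin, where every cutoff is 0, is a null set because n > 0; elsewhere the truncated
    integrands increase and are eventually equal to the full one. *)
Lemma integral_le_truncations (C : R) : (0 < n)%N ->
  (forall j, Cc (fj j)) -> (forall j, intg (fj j) <= C) ->
  (\int[lebesgue_rV n]_x (eucl_norm x `^ b * npow p (u x))%:E <= C%:E)%E.
Proof.
move=> n0 Cfj fC.
pose Z := [set x : 'rV[R]_n | `|x| <= 0].
have mZ : measurable Z by exact: measurable_cube.
have muZ : lebesgue_rV n Z = 0%E.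
  by rewrite lebesgue_rV_cube// mulr0 expr0n gtn_eqF.
have mD : measurable (setT `\` Z) by exact: measurableD.
have f0 x : (0 <= (eucl_norm x `^ b * npow p (u x))%:E)%E.
  by rewrite lee_fin mulr_ge0 ?powR_ge0 ?npow_ge0.
have fj0 j x : (0 <= (fj j x)%:E)%E.
  rewrite lee_fin; apply: mulr_ge0; last exact: npow_ge0.
  by rewrite ltW// wgt_gt0.
have mfj j : measurable_fun setT (fun x => (fj j x)%:E).
  by apply/measurable_EFinP; exact: Cc_measurable.
rewrite (@ge0_negligible_integral _ _ _ (lebesgue_rV n) setT Z)//; last first.
  by apply/measurable_EFinP; exact: measurable_weighted_power.
have cvgf x : (setT `\` Z) x -> (fj j x)%:E @[j --> \oo] -->
    (eucl_norm x `^ b * npow p (u x))%:E.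
  move=> [_ /negP]; rewrite -ltNge => x0.
  have sx : 0 < sqn x.
    rewrite lt0r sqn_ge0 andbT; apply: contraTN x0 => /eqP x0.
    by rewrite -leNgt (le_trans (norm_le_sqn x))// x0 sqrtr0.
  (* The cutoff is 1 at x as soon as 2 / (j+1) <= |x|^2. *)
  apply: cvg_near_cst; have [j0 j0P] := pow_inv_nat_small 2 1 (ler0n _ 2) ltr01 _ sx.
  near=> j; congr EFin; rewrite /fj wgt_npow_trunc// cutoff_eq1//.
    by rewrite powR1 mulr1.
  rewrite -[e j]powRr1 ?(ltW (e0 j))//; apply: j0P.
  by near: j; exists j0.
rewrite (_ : \int[lebesgue_rV n]_(x in setT `\` Z) _ =
    \int[lebesgue_rV n]_(x in setT `\` Z)
    (limn (fun j => (fj j x)%:E)))%E; last first.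
  apply: eq_integral => x; rewrite inE => xZ.
  by apply/esym/cvg_lim => //; exact: cvgf.
have cvgI := @cvg_monotone_convergence _ _ _ (lebesgue_rV n) (setT `\` Z) mD
  (fun j x => (fj j x)%:E) (fun j => measurable_funTS (mfj j)) (fun j x _ => fj0 j x)
  (fun x _ i j ij => le_wgt_npow_trunc i j x ij).
rewrite -(cvg_lim _ cvgI)//; apply: lime_le; first by apply/cvg_ex; eexists; exact: cvgI.
apply: nearW => j; apply: (@le_trans _ _ (\int[lebesgue_rV n]_x (fj j x)%:E)%E).
  by apply: ge0_subset_integral => // x _; exact: fj0.
by rewrite EFin_intg// lee_fin.
Unshelve. all: by end_near. Qed.

End limit.

Theorem theorem1p1 (R : realType) (N : nat) (alpha beta : R)
  (hN : (5 <= N)%N)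
  (halpha : 2 - N%:R < alpha)
  (hbeta1 : alpha - 2 < beta)
  (hbeta2 : beta <= N%:R / (N%:R - 2) * alpha) :
  let pstar : R := 2 * (N%:R + beta) / (N%:R - 4 + 2 * alpha - beta) in
  exists S : R, 0 < S /\
    forall u : 'rV[R]_N -> R, smooth u -> compactly_supported u ->
      (S%:E * (\int[lebesgue_rV N]_x
                 (eucl_norm x `^ beta * `|u x| `^ pstar)%:E) `^ (2 / pstar)
       <= \int[lebesgue_rV N]_x
            (eucl_norm x `^ (- beta) *
             `|divergence (fun y => eucl_norm y `^ alpha *: gradient u y) x|
               ^+ 2)%:E)%E.
Proof.
case: N hN halpha hbeta2 => [|[|n]]// hN halpha hbeta2.
have n3 : (3 <= n)%N by [].
set k := (n.+2%:R + beta) / (n.+2%:R - 4 + 2 * alpha - beta).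
move=> pstar; have {pstar} -> : pstar = 2 * k by rewrite /pstar /k mulrA.
have nu3 : (3 : R) <= n%:R by rewrite (ler_nat R 3).
have NE : n.+2%:R = n%:R + 2 :> R by rewrite -addn2 natrD.
have nua : 0 < (alpha + n%:R) / 2.
  by rewrite divr_gt0//; have := halpha; rewrite NE; lra.
have k1 := truncated_exponent_gt1 n alpha beta n3 halpha hbeta1 hbeta2.
rewrite -/k in k1.
have p0 : 0 < 2 * k by rewrite mulr_gt0// (lt_trans _ k1).
have [[K1 K2] /= [K10 K20] est] :=
  truncated_sobolev n alpha beta n3 halpha hbeta1 hbeta2.
rewrite -/k in est.
(* The limit bounds the integral by (K1 r^(1/2))^p, where r is the right-hand side of the theorem;
   its power 2/p is K1^2 r. *)
exists (K1 ^+ 2)^-1; split; first by rewrite invr_gt0 exprn_gt0.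
move=> u su /compactly_supported_vanish[M uM].
have udu := smooth_has_grad u su; have duddu := smooth_has_grad2 u su.
have Cu : Cc u by split; [case: udu|exists M].
have [B B0 uB] := Cc_bounded u Cu.
set g := fun x => (eucl_norm x `^ (- beta) *
  `|divergence (fun y => eucl_norm y `^ alpha *: gradient u y) x| ^+ 2)%:E.
have g0 x : (0 <= g x)%E by rewrite lee_fin mulr_ge0 ?powR_ge0 ?sqr_ge0.
have [goo|goo] := eqVneq (\int[lebesgue_rV n.+2]_x g x)%E +oo%E.
  by rewrite goo leey.
have Afin : (\int[lebesgue_rV n.+2]_x g x)%E \is a fin_num.
  by rewrite ge0_fin_numE ?integral_ge0// ltey.
rewrite -(fineK Afin); set r := fine _.
have r0 : 0 <= r by apply: fine_ge0; exact: integral_ge0.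
pose e (j : nat) : R := j.+1%:R^-1.
have e0 j : 0 < e j by rewrite invr_gt0.
set s := 4 * k / (k + 1) in est.
pose f j x := wgt (e j) beta x * npow s (trunc (e j) k u x).
have Cf j : Cc (f j) by exact: Cc_npow_trunc (e0 j) k1 udu uM.
have Xle : forall j, intg (f j) <= (K1 * Num.sqrt r) `^ (2 * k).
  have P0 : 0 <= K1 * Num.sqrt r.
    by apply: mulr_ge0; [exact: ltW|exact: sqrtr_ge0].
  have Q0 : 0 <= K2 * B `^ (k + 1).
    by apply: mulr_ge0 => //; exact: powR_ge0.
  apply: (powR_le_of_perturbed_bounds (fun j => intg (f j))
    (fun j => 1 * e j `^ ((alpha + n%:R) / 2)) _ _ _ p0 P0 Q0).
  - move=> j; apply: intg_ge0 => x; apply: mulr_ge0; last exact: npow_ge0.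
    by rewrite ltW// wgt_gt0.
  - move=> i j ij; apply: le_intg; [exact: Cf|exact: Cf|move=> x].
    exact: le_wgt_npow_trunc.
  - exact: (pow_inv_nat_small 1 _ ler01 nua).
  move=> j; have := est u _ _ M B udu duddu uM uB (e j) (e0 j).
  move/le_trans; apply; rewrite mul1r mulrA lerD2r.
  apply: ler_wpM2r; first exact: powR_ge0.
  apply: ler_wpM2l; first exact: ltW.
  apply: ler_wsqrtr; rewrite -lee_fin [r%:E]fineK//.
  have CA := Cc_wdiv_energy (e j) alpha beta M u _ _ (e0 j) udu duddu uM.
  (* The truncated energy is at most r for every j: its integrand is 0 where |x|^2 <= e_j, and
     elsewhere [wdiv] is the true divergence and the cutoff is at most 1. *)
  rewrite /wdiv_energy -(EFin_intg _ CA); apply: ge0_le_integral_nonmeasurable => x.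
    rewrite lee_fin; apply: mulr_ge0; first by rewrite ltW// wgt_gt0.
    by apply: mulr_ge0; exact: sqr_ge0.
  have [xe|ex] := leP (sqn x) (e j).
    by rewrite cutoff_eq0// expr0n/= !mulr0.
  rewrite /g lee_fin (divergence_wdiv u su (e j))// (wgtE _ _ _ (ltW ex)).
  rewrite real_normK ?num_real//; apply: ler_wpM2l; first exact: powR_ge0.
  apply: ler_piMr; first exact: sqr_ge0.
  by rewrite exprn_ile1 ?cutoff_ge0 ?cutoff_le1.
have cu : continuous u by case: udu.
have Ile := integral_le_truncations beta k u k1 cu _ isT Cf Xle.
have I0 : (0 <= \int[lebesgue_rV n.+2]_x
    (eucl_norm x `^ beta * npow (2 * k) (u x))%:E)%E.
  by apply: integral_ge0 => x _; rewrite lee_fin mulr_ge0 ?powR_ge0 ?npow_ge0.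
apply: (@le_trans _ _ (((K1 ^+ 2)^-1)%:E *
    ((K1 * Num.sqrt r) `^ (2 * k))%:E `^ (2 / (2 * k)))%E).
  apply: lee_wpmul2l; first by rewrite lee_fin invr_ge0 sqr_ge0.
  have q0 : 0 <= 2 / (2 * k) by rewrite divr_ge0// ltW.
  apply: (gt0_ler_poweR q0) => //; rewrite in_itv/= leey andbT//.
  by rewrite lee_fin powR_ge0.
rewrite poweR_EFin -powRrM mulrCA mulfV ?gt_eqF// mulr1 -EFinM lee_fin.
rewrite powR_mulrn; last by rewrite mulr_ge0 ?sqrtr_ge0// ltW.
rewrite exprMn sqr_sqrtr// mulrA mulVf ?mul1r//.
by rewrite expf_neq0// gt_eqF.
Qed.
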